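(* Let $\{X_t,t\ge 0\}$ be a continuous-time Markov chain on a countable state space $I$ with honest, standard transition function $P(t,x,y)$, regular $Q$-matrix and almost surely infinite first flying time (all as described in the context), and let $x\in I$. Let $w:[0,\infty)\to[0,\infty)$ satisfy Condition (C): $w$ is non-negative and increasing on $[0,\infty)$, and for some $t_0>0$ it is twice differentiable on $[t_0,\infty)$ with $w''(t)<0$ for $t\in[t_0,\infty)$ and $\lim_{t\to\infty}w'(t)=0$. Then the following conditions are mutually equivalent: (1) $E^x(w(\tau_x))<\infty$. (2) $\displaystyle\int^\infty |w''(t)|\,\frac{t}{S_t(x,x)}\,dt<\infty$. (3) $\displaystyle\int^\infty |w''(t)|\,\frac{t}{G_{1/t}(x,x)}\,dt<\infty$. (4) $\displaystyle\int^\infty |w''(t)|\,\bigl(t-tE^x(e^{-\tau_x/t})\bigr)\,dt<\infty$.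
   Context: $\{X_t,t\ge0\}$ is a continuous-time Markov chain on a countable state space $I$ with transition function $P(t,x,y)=P(X_t=y\mid X_0=x)$, which is honest ($\sum_{y\in I}P(t,x,y)=1$) and standard ($\lim_{t\downarrow0}P(t,x,y)=\delta_{xy}$). Its $Q$-matrix $q_{xy}=\lim_{t\downarrow 0}(P(t,x,y)-\delta_{xy})/t$ is regular: $0\le q_{xy}<\infty$ for $x\ne y$, $0<q_x:=-q_{xx}<\infty$, and $\sum_{y\in I}q_{xy}=0$. Let $\eta_1<\eta_2<\cdots$ be the successive jump times; it is assumed that the first flying time $\eta=\lim_n\eta_n$ is almost surely infinite (the process is non-explosive). $P^x,E^x$ denote law and expectation for the process started at $x$. The first returning time of $x$ is $\tau_x=\inf\{t>\eta_1: X_t=x\}$ (with $\inf\emptyset=\infty$, $w(\infty):=\lim_{t\to\infty}w(t)\in[0,\infty]$, $e^{-\infty}=0$). Further, $S_t(x,x)=\int_0^tP(s,x,x)\,ds$ and $G_\alpha(x,x)=\int_0^\infty e^{-\alpha t}P(t,x,x)\,dt$ for $\alpha>0$. $\int^\infty f(t)\,dt<\infty$ means that $\int_k^\infty f(t)\,dt<\infty$ for some (equivalently every) sufficiently large lower limit $k\geq t_0$. *)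

(* Defs.v *)
From mathcomp Require Import all_boot all_order all_algebra.
From mathcomp Require Import all_classical all_reals all_analysis.
Set Implicit Arguments.
Unset Strict Implicit.
Unset Printing Implicit Defensive.
Import Order.TTheory GRing.Theory Num.Theory.
Import numFieldNormedType.Exports.
Local Open Scope classical_set_scope.
Local Open Scope ring_scope.

(* Time is represented by the nonnegative elements of R; the values of the
   transition function, the process and w at negative times are irrelevant. *)

Record honest_standard_transition_function (R : realType) (I : countType)
    (p : R -> I -> I -> R) : Prop := HonestStandardTransitionFunction {
  transition_ge0 : forall (t : R) x y, 0 <= t -> 0 <= p t x y ;
  transition_honest : forall (t : R) x, 0 <= t ->
    (\esum_(y in [set: I]) (p t x y)%:E = 1)%E ;
  transition_chapman_kolmogorov : forall (s t : R) x z, 0 <= s -> 0 <= t ->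
    ((p (s + t) x z)%:E = \esum_(y in [set: I]) (p s x y * p t y z)%:E)%E ;
  transition_standard : forall x y,
    p t x y @[t --> 0^'+] --> ((x == y)%:R : R) }.

Definition is_Qmatrix (R : realType) (I : countType)
    (p : R -> I -> I -> R) (q : I -> I -> R) : Prop :=
  forall x y, (p t x y - (x == y)%:R) / t @[t --> 0^'+] --> q x y.

(* \esum is meant for nonnegative families, hence the diagonal term of
   \sum_y q x y is kept apart. *)
Record regular_Qmatrix (R : realType) (I : countType) (q : I -> I -> R) :
    Prop := RegularQmatrix {
  Qmatrix_offdiag : forall x y, x != y -> 0 <= q x y ;
  Qmatrix_diag : forall x, 0 < - q x x ;
  Qmatrix_row_sum : forall x,
    (\esum_(y in [set~ x]) (q x y)%:E + (q x x)%:E = 0)%E }.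

Definition cond_prob (R : realType) d (T : measurableType d)
    (P : probability T R) (A B : set T) : R :=
  fine (P (A `&` B)) / fine (P B).

(* P y is the law of the process started at y. *)
Record markov_chain (R : realType) (I : countType) (p : R -> I -> I -> R)
    d (T : measurableType d) (P : I -> probability T R) (X : R -> T -> I) :
    Prop := MarkovChain {
  chain_measurable : forall (t : R) y, 0 <= t -> measurable (X t @^-1` [set y]) ;
  chain_right_continuous : forall (t : R) omega, 0 <= t ->
    \forall s \near t^'+, X s omega = X t omega ;
  chain_start : forall y, (P y (X 0%R @^-1` [set y]) = 1)%E ;
  chain_markov : forall y n (s : nat -> R) (i : nat -> I) (t : R) z,
    0 <= s 0%N -> (forall k, (k < n)%N -> s k < s k.+1) -> 0 <= t ->
    let past := [set omega | forall k, (k <= n)%N -> X (s k) omega = i k] in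
    P y past != 0%E ->
    cond_prob (P y) (X (s n + t) @^-1` [set z]) past = p t (i n) z }.

Section RandomTimes.
Context (R : realType) (I : countType) d (T : measurableType d).
Variable X : R -> T -> I.
Local Open Scope ereal_scope.

(* The 0-th time is 0 and the n-th one, n >= 1, is the time of the n-th jump;
   ereal_inf set0 = +oo. *)
Fixpoint jump_time (n : nat) (omega : T) : \bar R :=
  if n is m.+1 then
    ereal_inf [set t%:E | t in [set t : R | jump_time m omega < t%:E /\
      X t omega <> X (fine (jump_time m omega)) omega]]
  else 0.

Definition flying_time (omega : T) : \bar R :=
  limn (fun n => jump_time n omega).

Definition return_time (x : I) (omega : T) : \bar R :=
  ereal_inf [set t%:E | t in [set t : R |
    jump_time 1 omega < t%:E /\ X t omega = x]].

End RandomTimes.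

Definition non_explosive (R : realType) (I : countType) d
    (T : measurableType d) (P : I -> probability T R) (X : R -> T -> I) :
    Prop :=
  forall y, {ae P y, forall omega, flying_time X omega = +oo%E}.

Definition S_ (R : realType) (I : countType) (p : R -> I -> I -> R)
    (t : R) (x : I) : R :=
  \int[lebesgue_measure]_(s in `[0, t]) p s x x.

Definition G_ (R : realType) (I : countType) (p : R -> I -> I -> R)
    (alpha : R) (x : I) : R :=
  \int[lebesgue_measure]_(t in `[0, +oo[) (expR (- (alpha * t)) * p t x x).

(* Since 0 < t0 and t0 can be enlarged, it does not matter whether the
   derivatives at the end point t0 are taken two-sided or one-sided. *)
Record condition_C (R : realType) (w : R -> R) (t0 : R) : Prop := ConditionC {
  condC_ge0 : forall t : R, 0 <= t -> 0 <= w t ;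
  condC_nondecreasing : forall s t : R, 0 <= s -> s <= t -> w s <= w t ;
  condC_t0_gt0 : 0 < t0 ;
  condC_derivable : forall t : R, t0 <= t -> derivable w t 1 ;
  condC_derivable2 : forall t : R, t0 <= t -> derivable (derive1 w) t 1 ;
  condC_lt0 : forall t : R, t0 <= t -> derive1n 2 w t < 0 ;
  condC_lim : derive1 w t @[t --> +oo] --> (0 : R) }.

(* Only used for u >= 0; the value at -oo is arbitrary. *)
Definition extend_at_infty (R : realType) (w : R -> R) (u : \bar R) : \bar R :=
  match u with
  | r%:E => (w r)%:E
  | +oo => lim ((w t)%:E @[t --> +oo%R])
  | -oo => 0
  end%E.

(* E^x (e^{- tau_x / t}), with expeR -oo = 0. *)
Definition return_laplace (R : realType) (I : countType) d
    (T : measurableType d) (P : I -> probability T R) (X : R -> T -> I)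
    (x : I) (t : R) : R :=
  fine (\int[P x]_omega expeR (- (return_time X x omega * (t^-1)%:E)))%E.

(* \int^oo f(t) dt < oo, for f nonnegative beyond t0. *)
Definition tail_integral_finite (R : realType) (t0 : R) (f : R -> R) : Prop :=
  exists2 k : R, t0 <= k &
    (\int[lebesgue_measure]_(t in `[k, +oo[) (f t)%:E < +oo)%E.

(* Main.v *)
(** Write tau for the return time, M(t) = E^x min(tau, t) and q = q_x.  All four
    conditions are equivalent to int^oo |w''(t)| M(t) dt < oo.

    For (1), w(u) = w(t_0) - t_0 w'(t_0) + int_(t_0)^oo |w''(s)| min(u, s) ds
    when u >= t_0, and Tonelli's theorem applies.  As w'' is not assumed to be
    continuous, this rests on the fundamental theorem of calculus for
    everywhere differentiable functions with nonnegative derivative.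

    For (4), t (1 - e^(-u/t)) lies between min(u, t) / 2 and min(u, t).

    For (2), the last-exit decomposition of the skeleton chain
    X_0, X_h, X_2h, ... with h = t/N gives, as N -> oo,
      t <= S_t (q + 1/t) M(t)   and   S_t q M(t) <= 2 t,
    so that t / S_t is comparable to M(t).

    For (3), these inequalities bound S_(nt) by a multiple of n S_t, hence
    G_(1/t) and S_t are comparable. *)
Require Import Defs.
From mathcomp Require Import all_boot all_order all_algebra.
From mathcomp Require Import all_classical all_reals all_analysis.
From mathcomp Require Import measurable_realfun ring lra.
Set Implicit Arguments.
Unset Strict Implicit.
Unset Printing Implicit Defensive.
Import Order.TTheory GRing.Theory Num.Theory.
Import numFieldNormedType.Exports.
Local Open Scope classical_set_scope.
Local Open Scope ring_scope.

(** * The fundamental theorem of calculus for everywhere differentiable functions *)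

(** The chain is given through its Markov property at finitely many deterministic times. On a
    skeleton, regeneration at visits of x follows from that by countable sums over trajectories,
    without a strong Markov property. The price is that a skeleton of small mesh h mostly revisits x
    at once, without having left it, whereas tau starts counting after the first jump. Hence two
    sequences are kept apart: r_j, the probability of no visit to x in steps 1, ..., j, which obeys
    the last-exit identity, and b_j, the probability that no departure followed by a visit is seen
    up to step j, whose sum times h tends to M(t). With a = p(h, x, x) they are linked by r_j = b_j
    - a b_(j-1). Summation leaves the factor 1 - a, which is about q h, and a boundary term at most
    the average of b, which is the origin of 1/t in the first inequality for S_t. *)

Section VitaliCaratheodory.
Context {R : realType}.
Local Notation mu := (@lebesgue_measure R).

(* Compare f with the indefinite integral of G, which grows at least as fast
   to the right of every point. *)
Lemma increment_le_integral (f : R -> R) (G : R -> \bar R) (a b : R) :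
  a <= b -> measurable_fun (`[a, b] : set R) G ->
  (forall x, a <= x <= b -> (0 <= G x)%E) ->
  (forall x, a <= x <= b -> {for x, continuous f}) ->
  (forall x, a <= x < b -> exists c : R, [/\ 0 <= c,
     \forall y \near x^'+, f y - f x <= c * (y - x) &
     \forall y \near x^'+, (c%:E <= G y)%E]) ->
  ((f b - f a)%:E <= \int[mu]_(x in `[a, b]) G x)%E.
Proof.
move=> ab mG G0 cf growth.
pose Phi y := (\int[mu]_(x in `[a, y]) G x)%E.
have Phi_le y z : y <= z -> z <= b -> (Phi y <= Phi z)%E.
  move=> yz zb; apply: ge0_subset_integral => //.
  - apply: measurable_funS mG => //.
    by apply: subset_itvl; rewrite bnd_simp.
  - move=> x /=; rewrite in_itv/= => /andP[ax xz]; apply: G0.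
    by rewrite ax (le_trans xz).
  - by apply: subset_itvl; rewrite bnd_simp.
pose A := [set y | a <= y <= b /\ ((f y - f a)%:E <= Phi y)%E].
have Aa : A a.
  split; first by rewrite lexx ab.
  by rewrite subrr /Phi set_itv1 integral_set1.
have supA : has_sup A.
  split; first by exists a.
  by exists b => y [/andP[]].
pose c := sup A.
have ac : a <= c by apply: ub_le_sup => //; case: supA.
have cb : c <= b by apply: ge_sup => [|y [/andP[]]//]; exists a.
have cab : a <= c <= b by rewrite ac.
have Ac : A c.
  split=> //; rewrite leNgt; apply/negP => Phic.
  (* Failure of the inequality at c makes [Phi c] finite. Then f - f a stays above r near c, while a
     point of [A] close to c bounds it by [Phi c] = r. *)
  have [r [rE rlt]] : exists r, Phi c = r%:E /\ r < f c - f a.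
    have Phi0 : (0 <= Phi c)%E.
      apply: integral_ge0 => x /=; rewrite in_itv/= => /andP[ax xc].
      by apply: G0; rewrite ax (le_trans xc).
    move: Phi0 Phic; case: (Phi c) => [r| |]//= _.
    by rewrite lte_fin => ?; exists r.
  have : \forall y \near c, r < f y - f a.
    have : f y - f a @[y --> c] --> f c - f a.
      by apply: cvgB; [exact: cf|exact: cvg_cst].
    by move/(@cvgr_gt _ _ _ _ _ _); apply.
  move=> /nbhs_ballP[e /= e0 He].
  have [y Ay yc] := sup_adherent e0 supA.
  have ycle : y <= c by apply: ub_le_sup => //; case: supA.
  have := He y; rewrite /ball/= ger0_norm ?subr_ge0// => /(_ _).
  have -> : c - y < e by move: yc; rewrite -/c; lra.
  move=> /(_ isT); case: Ay => _.
  move=> /le_trans/(_ (Phi_le _ _ ycle cb)); rewrite rE lee_fin => h1 h2; lra.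
have [cb'|] := ltP c b; last first.
  move=> bc; have <- : c = b by apply/eqP; rewrite eq_le cb.
  by case: Ac.
exfalso.
have [k [k0 fk Gk]] : exists k : R, [/\ 0 <= k,
     \forall y \near c^'+, f y - f c <= k * (y - c) &
     \forall y \near c^'+, (k%:E <= G y)%E].
  by apply: growth; rewrite ac.
have [e /= e0 He] := fk.
have [e' /= e0' He'] := Gk.
(* The halves keep y strictly inside both neighbourhoods, and the cap [b - c] keeps it in [a, b]. *)
pose y := c + Num.min (Num.min (e / 2) (e' / 2)) (b - c).
have [ye [ye' [yb cy]]] : y - c < e /\ (y - c < e' /\ (y <= b /\ c < y)).
  rewrite /y; have : 0 < b - c by lra.
  by case: (lerP (e / 2) (e' / 2)) => h1; rewrite minEle; case: ifPn => h2 h3;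
    lra.
have : A y.
  split; first by apply/andP; split=> //; lra.
  have fy : f y - f c <= k * (y - c).
    by apply: He => //=; rewrite /ball_/= distrC ger0_norm; lra.
  have <- : (Phi c + \int[mu]_(x in `]c, y]) G x)%E = Phi y.
    have acy : `[a, y]%classic = `[a, c] `|` `]c, y].
      by apply: itv_bndbnd_setU; rewrite bnd_simp// ltW.
    rewrite -ge0_integral_setU//.
    - by rewrite -acy.
    - rewrite -acy; apply: measurable_funS mG => //.
      by apply: subset_itvl; rewrite bnd_simp.
    - move=> x xin; apply: G0; move: xin => /=.
      by rewrite !in_itv/= => -[/andP[]|/andP[]]; lra.
    - by rewrite disj_set2E; apply/eqP; apply/seteqP; split=> // x /=;
        rewrite !in_itv/= => -[/andP[_ h1] /andP[h2 _]]; lra.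
  have -> : f y - f a = (f c - f a) + (f y - f c) by lra.
  rewrite EFinD; apply: leeD; first by case: Ac.
  apply: (@le_trans _ _ (\int[mu]_(x in `]c, y]) (cst k%:E x))%E).
    rewrite integral_cst//= lebesgue_measure_itv/= lte_fin cy -EFinD -EFinM.
    by rewrite lee_fin.
  apply: ge0_le_integral => //.
  - apply: measurable_funS mG => //= x /=; rewrite !in_itv/=; lra.
  - move=> x /=; rewrite in_itv/= => /andP[cx xy]; apply: He' => //=.
    by rewrite /ball_/= distrC ger0_norm; lra.
move=> Ay; have : y <= c by apply: ub_le_sup => //; case: supA.
by rewrite leNgt cy.
Qed.

End VitaliCaratheodory.

Section Semicontinuous.
Context {R : realType}.
Local Notation mu := (@lebesgue_measure R).

(* Cover each level set of g by an open set of nearly the same measure. *)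
Lemma lower_semicontinuous_majorant (g : R -> R) (a b e : R) :
  a <= b -> 0 < e -> measurable_fun (`[a, b] : set R) g ->
  (forall x, a <= x <= b -> 0 <= g x) ->
  exists G : R -> \bar R,
    [/\ measurable_fun [set: R] G, (forall x, (0 <= G x)%E),
        (forall x, a <= x <= b -> exists c : R,
           [/\ 0 <= c, g x < c & \forall y \near x, (c%:E <= G y)%E]) &
        (\int[mu]_(x in `[a, b]) G x <=
         \int[mu]_(x in `[a, b]) (g x)%:E + e%:E)%E].
Proof.
move=> ab e0 mg g0.
(* Two errors share e: rounding g up to the next level costs s (b - a), and the excess measure of
   the open sets costs s in total. *)
pose s : R := e / (b - a + 1).
have ba0 : 0 < b - a + 1 by lra.
have s0 : 0 < s by rewrite divr_gt0.
pose E n := `[a, b] `&` g @^-1` `[n%:R * s, n.+1%:R * s[ : set R.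
have mE n : measurable (E n) by apply: mg => //; exact: measurable_itv.
have muE n : (mu (E n) < +oo)%E.
  apply: (@le_lt_trans _ _ (mu `[a, b])).
    by apply: le_measure; rewrite ?inE//; [exact: mE|exact: subIsetl].
  by rewrite lebesgue_measure_itv/=; case: ifP => _; rewrite -?EFinB ltry.
(* The n-th open set has height (n + 1) s, so its excess costs at most s / 2^(n+1), which sums to
   s. *)
pose d n : R := s / (2 ^ n.+1)%:R / (n.+1%:R * s).
have ns0 n : 0 < n.+1%:R * s :> R by rewrite mulr_gt0// ltr0n.
have d0 n : 0 < d n by rewrite !divr_gt0// ltr0n expn_gt0.
pose V n := projT1 (cid (lebesgue_regularity_outer (mE n) (muE n) (d0 n))).
have VP n : [/\ open (V n), E n `<=` V n & (mu (V n `\` E n) < (d n)%:E)%E].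
  by rewrite /V; case: cid.
have mV n : measurable (V n) by apply: open_measurable; case: (VP n).
have mVI n : measurable (V n `&` `[a, b]) by exact: measurableI.
have mVD n : measurable (V n `\` E n) by exact: measurableD.
have mVU n : measurable (E n `|` V n `\` E n) by exact: measurableU.
have mgE : measurable_fun (`[a, b] : set R) (EFin \o g) by exact/measurable_EFinP.
have mgs : measurable_fun (`[a, b] : set R) (fun x => (g x)%:E + s%:E)%E.
  by apply: emeasurable_funD => //; exact/measurable_EFinP.
have mbE : measurable (\bigcup_n E n) by exact: bigcup_measurable.
have mgsE n : measurable_fun (E n) (fun x => (g x)%:E + s%:E)%E.
  by apply: measurable_funS mgs => // x [].
pose h n x : \bar R := ((n.+1%:R * s)%:E * (\1_(V n) x)%:E)%E.
have h0 n x : (0 <= h n x)%E.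
  by apply: mule_ge0; rewrite lee_fin ?ler0n // ltW.
have mh n (D : set R) : measurable_fun D (h n).
  apply/emeasurable_funM; first exact: measurable_cst.
  by apply/measurable_EFinP; exact: measurable_indic.
(* At a point of [E n] the single term [h n] already exceeds g, and it does so on the whole open set
   [V n]; this yields the locally constant lower bound. *)
pose G x : \bar R := (\sum_(n <oo) h n x)%E.
have hG n x : (h n x <= G x)%E.
  rewrite /G (@nneseriesD1 _ _ n)// leeDl//.
  exact: nneseries_ge0.
exists (G : R -> \bar R); split.
- by apply: ge0_emeasurable_sum => // k x _ _; exact: h0.
- by move=> x; apply: nneseries_ge0.
- move=> x xab; pose n := Num.truncn (g x / s).
  have gs0 : 0 <= g x / s by apply: divr_ge0; [exact: g0|exact: ltW].
  have /andP[n1 n2] := truncn_itv gs0.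
  have Ex : E n x.
    split; first by rewrite /= in_itv/=.
    by rewrite /= in_itv/= -ler_pdivlMr// -ltr_pdivrMr// n1.
  exists (n.+1%:R * s); split; first exact: ltW.
    by case: Ex => _ /=; rewrite in_itv/= => /andP[].
  have [oV EV _] := VP n.
  have : nbhs x (V n) by apply: open_nbhs_nbhs; split=> //; exact: EV.
  apply: filterS => y Vy; apply: le_trans (hG n y).
  by rewrite /h indicE mem_set// mule1.
- rewrite /G integral_nneseries//; last by move=> n; exact: mh.
  have sumE : (\sum_(n <oo) \int[mu]_(x in `[a, b]) h n x <=
     \sum_(n <oo) (\int[mu]_(x in E n) ((g x)%:E + s%:E)
                   + (s / (2 ^ n.+1)%:R)%:E))%E.
    apply: lee_nneseries => [n _ _|n _]; first exact: integral_ge0.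
    rewrite /h ge0_integralZl_EFin; last 4 first.
    - exact: measurable_itv.
    - by move=> x _; rewrite lee_fin.
    - have mI : measurable_fun (`[a, b] : set R) (\1_(V n) : R -> R).
        exact: measurable_indic.
      by apply/measurable_EFinP.
    - exact: ltW.
    rewrite integral_indic//; last exact: mV.
    apply: (@le_trans _ _ ((n.+1%:R * s)%:E * (mu (E n) + (d n)%:E))%E).
      apply: lee_wpmul2l; first by rewrite lee_fin ltW.
      have [_ EV /ltW dV] := VP n.
      apply: (@le_trans _ _ (mu (E n `|` V n `\` E n))).
        apply: le_measure; rewrite ?inE.
        - exact: mVI.
        - exact: mVU.
        - by move=> x [Vx _]; have [|] := pselect (E n x); [left|right].
      have hU := measureU2 mu (mE n) (mVD n).
      apply: (le_trans hU).
      exact: leeD.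
    rewrite ge0_muleDr//; last by rewrite lee_fin ltW.
    apply: leeD.
      rewrite -(integral_cst mu (mE n)).
      apply: ge0_le_integral; first exact: mE.
      - by move=> x _; rewrite /= lee_fin ltW.
      - exact: measurable_cst.
      - exact: mgsE.
      - move=> x [_ /=]; rewrite in_itv/= => /andP[ng _].
        by rewrite -EFinD lee_fin -natr1 mulrDl mul1r lerD2r.
    rewrite -EFinM lee_fin /d mulrC divfK//; exact: lt0r_neq0.
  apply: (le_trans sumE).
  apply: (le_trans (epsilon_trick _ _ _)).
  + move=> n; apply: integral_ge0 => x [/=]; rewrite in_itv/= => xab _.
    by rewrite -EFinD lee_fin addr_ge0 ?g0// ltW.
  + exact: ltW.
  have gs0 x : `[a, b]%classic x -> (0 <= (g x)%:E + s%:E)%E.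
    rewrite /= in_itv/= => xab.
    by rewrite -EFinD lee_fin addr_ge0 ?g0// ltW.
  have Eab : \bigcup_n E n `<=` `[a, b] by move=> x [n _ []].
  rewrite -ge0_integral_bigcup//; last 3 first.
  - exact: measurable_funS mgs.
  - by move=> x /Eab; exact: gs0.
  - apply/trivIsetP => i j _ _ ij; apply/seteqP; split=> // x [].
    move=> [_ /=]; rewrite in_itv/= => /andP[i1 i2].
    move=> [_ /=]; rewrite in_itv/= => /andP[j1 j2].
    have : (i < j.+1)%N by rewrite -(ltr_nat R) -(ltr_pM2r s0) (le_lt_trans i1).
    have : (j < i.+1)%N by rewrite -(ltr_nat R) -(ltr_pM2r s0) (le_lt_trans j1).
    rewrite !ltnS => ji ij'; move/eqP: ij; apply; apply/eqP.
    by rewrite eqn_leq ij'.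
  apply: (@le_trans _ _ (\int[mu]_(x in `[a, b]) ((g x)%:E + s%:E) + s%:E)%E).
    apply: leeD => //; apply: ge0_subset_integral => //.
  rewrite ge0_integralD//; last first.
  - by move=> x _; rewrite lee_fin ltW.
  rewrite (integral_cst mu)//= lebesgue_measure_itv/= -addeA leeD2l//.
  have se : s * (b - a) + s = e.
    by rewrite -{2}(mulr1 s) -mulrDr /s mulfVK// lt0r_neq0.
  case: ifP => [_|]; first by rewrite -EFinB -EFinM -EFinD se.
  by rewrite mule0 add0e lee_fin -se lerDr mulr_ge0 ?subr_ge0// ltW.
Qed.
End Semicontinuous.

Section EverywhereDifferentiable.
Context {R : realType}.
Local Notation mu := (@lebesgue_measure R).

(** The majorant of g leaves a strict gap: f' x <= g x < c, so the difference quotients just to the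
    right of x stay below c, as the growth condition demands. Then the error e tends to 0. *)
Lemma increment_le_integral_derive (f g : R -> R) (a b : R) :
  a <= b -> measurable_fun (`[a, b] : set R) g ->
  (forall x, a <= x <= b -> 0 <= g x) ->
  (forall x, a <= x <= b -> derivable f x 1) ->
  (forall x, a <= x <= b -> derive1 f x <= g x) ->
  ((f b - f a)%:E <= \int[mu]_(x in `[a, b]) (g x)%:E)%E.
Proof.
move=> ab mg g0 df dfg; apply/lee_addgt0Pr => e e0.
have [G [mG G0 Gg Ge]] := lower_semicontinuous_majorant ab e0 mg g0.
apply: le_trans Ge; apply: increment_le_integral => //.
- exact: measurable_funTS.
- by move=> x xab; apply: differentiable_continuous; exact/derivable1_diffP/df.
- move=> x /andP[ax xb]; have xab : a <= x <= b by rewrite ax ltW.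
  have [c [c0 gc cG]] := Gg _ xab; exists c; split=> //; last first.
    exact: cvg_at_right_filter cG.
  have /cvg_ex[l lE] := df _ xab.
  have ll : l < c.
    have <- : derive1 f x = l by rewrite derive1E /derive; exact: cvg_lim.
    by apply: le_lt_trans gc; exact: dfg.
  have := @cvgr_lt _ _ _ _ _ _ lE _ ll.
  case=> r /= r0 rH.
  exists r => //= y /= xyr xy; rewrite -ler_pdivrMr ?subr_gt0//.
  have := rH (y - x); rewrite /ball_/= add0r normrN distrC => /(_ xyr).
  rewrite subr_eq0 gt_eqF// => /(_ isT).
  by rewrite /GRing.scale/= mulr1 subrK mulrC => /ltW.
Qed.

Lemma ge0_integral_derive (f : R -> R) (a b : R) :
  a <= b -> measurable_fun (`[a, b] : set R) (derive1 f) ->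
  (forall x, a <= x <= b -> derivable f x 1) ->
  (forall x, a <= x <= b -> 0 <= derive1 f x) ->
  (\int[mu]_(x in `[a, b]) (derive1 f x)%:E = (f b - f a)%:E)%E.
Proof.
move=> ab mf df f0; apply/eqP; rewrite eq_le; apply/andP; split; last first.
  exact: increment_le_integral_derive.
(* Integrability of f' is not known yet, so truncate it at n and use that
   n y - f y has derivative at most the nonnegative n - m n. *)
pose m n x := Num.min (derive1 f x) n%:R.
have mm n : measurable_fun (`[a, b] : set R) (m n).
  by apply: measurable_minr.
have m0 n x : a <= x <= b -> 0 <= m n x.
  by move=> xab; rewrite le_min f0//= ler0n.
have mle n : (\int[mu]_(x in `[a, b]) (m n x)%:E <= (f b - f a)%:E)%E.
  have h x : a <= x <= b ->
      is_derive x 1 (fun y : R => n%:R * y - f y) (n%:R - derive1 f x).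
    move=> xab; have dfx := df _ xab.
    have H : is_derive x (1:R) f (derive1 f x) by rewrite derive1E; exact: derivableP.
    by apply: is_derive_eq; rewrite /GRing.scale/= mulr1.
  have mnm : measurable_fun (`[a, b] : set R) (fun x => n%:R - m n x).
    exact: measurable_funB.
  have nm0 x : a <= x <= b -> 0 <= n%:R - m n x.
    by move=> xab; rewrite subr_ge0 ge_min lexx orbT.
  have H := @increment_le_integral_derive (fun y : R => n%:R * y - f y)
    (fun x => n%:R - m n x) a b ab mnm nm0.
  have h1 x : a <= x <= b -> derivable (fun y : R => n%:R * y - f y) x 1.
    by case/h.
  have h2 x : a <= x <= b ->
      derive1 (fun y : R => n%:R * y - f y) x <= n%:R - m n x.
    move=> xab; rewrite derive1E; have [_ ->] := h _ xab.
    by rewrite lerD2l lerN2 ge_min lexx.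
  move: (H h1 h2).
  have mnmE : measurable_fun (`[a, b] : set R) (fun x => (n%:R - m n x)%:E).
    exact/measurable_EFinP.
  have mmE : measurable_fun (`[a, b] : set R) (fun x => (m n x)%:E).
    exact/measurable_EFinP.
  have nm0E x : `[a, b]%classic x -> (0 <= (n%:R - m n x)%:E)%E.
    by rewrite /= in_itv/= => xab; rewrite lee_fin nm0.
  have m0E x : `[a, b]%classic x -> (0 <= (m n x)%:E)%E.
    by rewrite /= in_itv/= => xab; rewrite lee_fin m0.
  have : (\int[mu]_(x in `[a, b]) (n%:R - m n x)%:E +
          \int[mu]_(x in `[a, b]) (m n x)%:E = (n%:R * (b - a))%:E)%E.
    rewrite -ge0_integralD//.
    under eq_integral do rewrite -EFinD subrK.
    rewrite (integral_cst mu)//= lebesgue_measure_itv/=; case: ifPn => // ba.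
    rewrite mule0; have -> : b - a = 0.
      by apply/eqP; rewrite subr_eq0 eq_le ab andbT leNgt.
    by rewrite mulr0.
  have : (0 <= \int[mu]_(x in `[a, b]) (m n x)%:E)%E.
    by apply: integral_ge0 => x /=; rewrite in_itv/= => xab; rewrite lee_fin m0.
  have : (0 <= \int[mu]_(x in `[a, b]) (n%:R - m n x)%:E)%E.
    by apply: integral_ge0 => x /=; rewrite in_itv/= => xab; rewrite lee_fin nm0.
  case: (integral _ _ _) => [r1| |]//; case: (integral _ _ _) => [r2| |]// _ _.
  by rewrite -EFinD => -[rE]; rewrite !lee_fin; lra.
have -> : (\int[mu]_(x in `[a, b]) (derive1 f x)%:E =
    \int[mu]_(x in `[a, b]) limn (fun n => (m n x)%:E))%E.
  apply: eq_integral => x _; apply/esym/cvg_lim => //.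
  apply: cvg_near_cst.
  exists (Num.bound `|derive1 f x|) => // n /= Nn.
  rewrite /m min_l// (le_trans (ler_norm _))// (le_trans (ltW (archi_boundP _)))//.
  by rewrite ler_nat.
have mE n : measurable_fun (`[a, b] : set R) (fun x => (m n x)%:E).
  exact/measurable_EFinP.
have mE0 n x : `[a, b]%classic x -> (0 <= (m n x)%:E)%E.
  by rewrite /= in_itv/= => xab; rewrite lee_fin m0.
have m_nd x : `[a, b]%classic x ->
    {homo (fun n => (m n x)%:E) : n k / (n <= k)%N >-> (n <= k)%E}.
  by move=> _ n k nk; rewrite lee_fin /m le_min ge_min lexx/= ge_min ler_nat nk orbT.
rewrite monotone_convergence//.
apply: lime_le; last by apply: nearW => n; exact: mle.
apply: ereal_nondecreasing_is_cvgn => n k nk.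
apply: ge0_le_integral => //; [exact: mE0|exact: mE|exact: mE|].
by move=> x xab; exact: m_nd.
Qed.
End EverywhereDifferentiable.

(** * Concave weights *)

Section DeriveHalfLine.
Context {R : realType}.
Local Notation mu := (@lebesgue_measure R).

Lemma derivable_continuous (g : R -> R) (x : R) :
  derivable g x 1 -> {for x, continuous g}.
Proof. by move=> dg; apply: differentiable_continuous; exact/derivable1_diffP. Qed.

Lemma measurable_fun_halfline (g : R -> R) (a : R) :
  (forall x, a <= x -> {for x, continuous g}) ->
  measurable_fun (`[a, +oo[ : set R) g.
Proof.
move=> dg; apply: subspace_continuous_measurable_fun => //.
apply: continuous_in_subspaceT => x; rewrite inE/= in_itv/= andbT => ax.
exact: dg.
Qed.

Lemma derivable_cvg_quotient (g : R -> R) (x : R) : derivable g x 1 ->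
  n.+1%:R * (g (x + n.+1%:R^-1) - g x) @[n --> \oo] --> derive1 g x.
Proof.
move=> dg.
have H : h^-1 *: (g (h + x) - g x) @[h --> 0^'] --> derive1 g x.
  have -> : (fun h => h^-1 *: (g (h + x) - g x)) =
            (fun h => h^-1 *: ((g \o shift x) (h *: (1:R)) - g x)).
    by apply/funext => h /=; rewrite /GRing.scale/= mulr1.
  by rewrite derive1E; exact: dg.
have K : (n.+1%:R^-1 : R) @[n --> \oo] --> (0 : R)^'.
  move=> A /=; case=> e /= e0 eA.
  have := @near_infty_natSinv_lt R (PosNum e0).
  apply: filterS => n /= ne; apply: eA => //=.
  by rewrite sub0r normrN ger0_norm// invr_ge0.
have := cvg_comp _ _ K H; apply: cvg_trans; apply: near_eq_cvg.
by apply: nearW => n /=; rewrite invrK [_ + x]addrC.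
Qed.

(** The derivative is a pointwise limit of difference quotients with positive steps. A half-line is
    stable under shifts to the right, so these quotients are continuous on it. *)
Lemma measurable_derive1_halfline (g : R -> R) (a : R) :
  (forall x, a <= x -> derivable g x 1) ->
  measurable_fun (`[a, +oo[ : set R) (derive1 g).
Proof.
move=> dg.
pose h (n : nat) (x : R) : R := n.+1%:R * (g (x + n.+1%:R^-1) - g x).
have mh n : measurable_fun (`[a, +oo[ : set R) (h n).
  apply: measurable_funM => //; apply: measurable_funB; last first.
    by apply: measurable_fun_halfline => x ax; exact: derivable_continuous (dg _ ax).
  apply: (@measurable_fun_halfline (fun x => g (x + n.+1%:R^-1))) => x ax.
  rewrite -[fun x => g _]/(g \o (fun x => x + n.+1%:R^-1)).
  apply: continuous_comp.
    by apply: cvgD; [exact: cvg_id|exact: cvg_cst].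
  by apply: derivable_continuous; apply: dg; rewrite (le_trans ax)// lerDl invr_ge0.
apply: (measurable_fun_cvg mh) => x; rewrite /= in_itv/= andbT => ax.
exact: derivable_cvg_quotient (dg _ ax).
Qed.
End DeriveHalfLine.

Section ConcaveWeight.
Context {R : realType}.
Local Notation mu := (@lebesgue_measure R).

Lemma ge0_integral_is_derive (f f' : R -> R) (a b : R) :
  a <= b -> measurable_fun (`[a, b] : set R) f' ->
  (forall x, a <= x <= b -> is_derive x (1 : R) f (f' x)) ->
  (forall x, a <= x <= b -> 0 <= f' x) ->
  (\int[mu]_(x in `[a, b]) (f' x)%:E = (f b - f a)%:E)%E.
Proof.
move=> ab mf' df f'0.
have f'E x : a <= x <= b -> derive1 f x = f' x.
  by move=> xab; rewrite derive1E; have [_ ->] := df _ xab.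
rewrite -ge0_integral_derive//.
- by apply: eq_integral => x; rewrite inE/= in_itv/= => /f'E ->.
- apply: eq_measurable_fun mf' => x; rewrite inE/= in_itv/= => /f'E.
  by move=> ->.
- by move=> x /df[].
- by move=> x xab; rewrite f'E// f'0.
Qed.

Variables (w : R -> R) (t0 : R).
Hypothesis Hw : condition_C w t0.
Let v (s : R) := `|derive1n 2 w s|.

Let t0_gt0 : 0 < t0. Proof. exact: condC_t0_gt0 Hw. Qed.

Lemma condC_absE s : t0 <= s -> v s = - derive1 (derive1 w) s.
Proof. by move=> ts; rewrite /v ltr0_norm//; exact: condC_lt0 Hw _ ts. Qed.

Lemma measurable_condC_abs : measurable_fun (`[t0, +oo[ : set R) v.
Proof.
by apply: measurableT_comp => //; apply: measurable_derive1_halfline;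
  exact: condC_derivable2 Hw.
Qed.

Let dw1 s : t0 <= s -> is_derive s (1 : R) w (derive1 w s).
Proof.
by move=> ts; rewrite derive1E; apply/derivableP; exact: condC_derivable Hw _ ts.
Qed.

Let dw2 s : t0 <= s -> is_derive s (1 : R) (derive1 w) (- v s).
Proof.
move=> ts; rewrite condC_absE// opprK [X in is_derive _ _ _ X]derive1E.
by apply/derivableP; exact: condC_derivable2 Hw _ ts.
Qed.

Lemma integral_condC_abs a b : t0 <= a -> a <= b ->
  (\int[mu]_(s in `[a, b]) (v s)%:E = (derive1 w a - derive1 w b)%:E)%E.
Proof.
move=> ta ab.
have -> : derive1 w a - derive1 w b = - derive1 w b - - derive1 w a.
  by rewrite opprK addrC.
apply: (@ge0_integral_is_derive (fun s => - derive1 w s) v) => //.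
- apply: measurable_funS measurable_condC_abs => // x /=.
  by rewrite !in_itv/= andbT => /andP[ax _]; exact: le_trans ax.
- move=> x /andP[ax _]; have H := dw2 (le_trans ta ax).
  by rewrite -[v x]opprK; exact: is_deriveN.
- by move=> x _; exact: normr_ge0.
Qed.

(** Integration by parts read backwards: w s - s w'(s) has derivative -s w''(s) = s |w''(s)|. *)
Lemma integral_condC_mulr_abs a b : t0 <= a -> a <= b ->
  (\int[mu]_(s in `[a, b]) (s * v s)%:E =
   ((w b - b * derive1 w b) - (w a - a * derive1 w a))%:E)%E.
Proof.
move=> ta ab.
apply: (@ge0_integral_is_derive (fun s => w s - s * derive1 w s)
  (fun s => s * v s)) => //.
- apply: measurable_funM => //.
  apply: measurable_funS measurable_condC_abs => // x /=.
  by rewrite !in_itv/= andbT => /andP[ax _]; exact: le_trans ax.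
- move=> x /andP[ax _]; have tx := le_trans ta ax.
  have H1 := dw1 tx; have H2 := dw2 tx.
  apply: is_derive_eq; rewrite /GRing.scale/=; ring.
- move=> x /andP[ax _]; apply: mulr_ge0 (normr_ge0 _).
  by apply: le_trans ax; apply: le_trans ta; exact: ltW.
Qed.

(** The limit over the intervals [a, a + n]; the boundary term w'(a + n) vanishes because w' tends
    to 0. *)
Lemma integral_condC_abs_tail a : t0 <= a ->
  (\int[mu]_(s in `[a, +oo[) (v s)%:E = (derive1 w a)%:E)%E.
Proof.
move=> ta.
have mv : measurable_fun (`[a, +oo[ : set R) (fun s => (v s)%:E).
  apply/measurable_EFinP; apply: measurable_funS measurable_condC_abs => //.
  by move=> x /=; rewrite !in_itv/= !andbT; exact: le_trans.
have sub n : (`[a, a + n%:R] : set R) `<=` `[a, +oo[.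
  by move=> x /=; rewrite !in_itv/= andbT => /andP[].
have H : (\int[mu]_(s in `[a, (a + n%:R)%R]) (v s)%:E)%E @[n --> \oo]
    --> (\int[mu]_(s in `[a, +oo[) (v s)%:E)%E.
  rewrite itv_bndy_bigcup_BRight.
  apply: ge0_nondecreasing_set_cvg_integral => //.
  - move=> n m nm; apply/subsetPset; apply: subset_itvl.
    by rewrite bnd_simp lerD2l ler_nat.
  - by move=> n; apply: measurable_funS mv.
  - by move=> n x _; rewrite lee_fin normr_ge0.
apply: (cvg_unique _ H) => //.
have -> : (fun n : nat => \int[mu]_(s in `[a, (a + n%:R)%R]) (v s)%:E)%E =
    (fun n : nat => (derive1 w a - derive1 w (a + n%:R))%:E).
  by apply/funext => n; rewrite integral_condC_abs// lerDl.
apply: cvg_EFin; first exact: nearW.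
rewrite /comp/= -[X in _ --> X]subr0; apply: cvgB; first exact: cvg_cst.
have K : a + n%:R @[n --> \oo] --> +oo%R.
  apply/cvgryPge => M; exists (Num.bound `|M - a|) => // n /= Mn.
  rewrite -lerBlDl (le_trans (ler_norm _))// (le_trans (ltW (archi_boundP _)))//.
  by rewrite ler_nat.
exact: (cvg_comp _ _ K (condC_lim Hw)).
Qed.

End ConcaveWeight.

Section TruncatedWeight.
Context {R : realType}.
Variables (w : R -> R) (t0 : R).
Hypothesis Hw : condition_C w t0.
Local Notation mu := (@lebesgue_measure R).
Local Notation v s := `|derive1n 2 w s|.

(** The integral representation of w without its constants. Since u is extended, the value at +oo is
    the integral of s |w''(s)|, which covers paths that never return. *)
Definition truncated_weight (u : \bar R) : \bar R :=
  (\int[mu]_(s in `[t0, +oo[) ((v s)%:E * mine u s%:E))%E.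

Let t0_gt0 : 0 < t0. Proof. exact: condC_t0_gt0 Hw. Qed.

Lemma measurable_truncated_weight (u : \bar R) :
  measurable_fun (`[t0, +oo[ : set R) (fun s => (v s)%:E * mine u s%:E)%E.
Proof.
apply: emeasurable_funM.
  by apply/measurable_EFinP; exact: measurable_condC_abs Hw.
by apply: measurable_mine => //; exact/measurable_EFinP.
Qed.

Lemma truncated_weight_integrand_ge0 (u : \bar R) (s : R) : (0 <= u)%E ->
  (`[t0, +oo[%classic : set R) s -> (0 <= (v s)%:E * mine u s%:E)%E.
Proof.
move=> u0; rewrite /= in_itv/= andbT => ts; apply: mule_ge0.
  by rewrite lee_fin normr_ge0.
by rewrite le_min u0 lee_fin (le_trans _ ts)// ltW.
Qed.

Lemma truncated_weight_ge0 (u : \bar R) : (0 <= u)%E ->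
  (0 <= truncated_weight u)%E.
Proof.
by move=> u0; apply: integral_ge0 => s; exact: truncated_weight_integrand_ge0.
Qed.

Lemma le_truncated_weight (u u' : \bar R) : (0 <= u)%E -> (u <= u')%E ->
  (truncated_weight u <= truncated_weight u')%E.
Proof.
move=> u0 uu'; apply: ge0_le_integral => //.
- by move=> s; exact: truncated_weight_integrand_ge0.
- exact: measurable_truncated_weight.
- exact: measurable_truncated_weight.
- move=> s _; apply: lee_wpmul2l; first by rewrite lee_fin normr_ge0.
  by rewrite le_min ge_min uu'/= ge_min lexx orbT.
Qed.

(** Split at u: the boundary term -u w'(u) of the integral of s |w''(s)| cancels against u times the
    tail integral w'(u). *)
Lemma truncated_weight_fin (u : R) : t0 <= u ->
  truncated_weight u%:E = (w u - w t0 + t0 * derive1 w t0)%:E.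
Proof.
move=> tu; rewrite /truncated_weight.
have u0 : 0 <= u by apply: le_trans tu; exact: ltW.
have split_u : `[t0, +oo[%classic = (`[t0, u] `|` `]u, +oo[ : set R).
  by apply: itv_bndbnd_setU; rewrite bnd_simp.
have mK := measurable_truncated_weight u%:E.
have K0 s := @truncated_weight_integrand_ge0 u%:E s u0.
rewrite split_u ge0_integral_setU//; last 3 first.
- by rewrite -split_u.
- by rewrite -split_u.
- rewrite disj_set2E; apply/eqP; apply/seteqP; split=> // x /=.
  by rewrite !in_itv/= andbT => -[/andP[_ h1]]; rewrite ltNge h1.
have -> : (\int[mu]_(s in `[t0, u]) ((v s)%:E * mine u%:E s%:E) =
    \int[mu]_(s in `[t0, u]) (s * v s)%:E)%E.
  apply: eq_integral => s; rewrite inE/= in_itv/= => /andP[_ su].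
  by rewrite min_r ?lee_fin// -EFinM mulrC.
rewrite (integral_condC_mulr_abs Hw)//.
have -> : (\int[mu]_(s in `]u, +oo[) ((v s)%:E * mine u%:E s%:E) =
    \int[mu]_(s in `]u, +oo[) (u%:E * (v s)%:E))%E.
  apply: eq_integral => s; rewrite inE/= in_itv/= andbT => /ltW us.
  by rewrite min_l ?lee_fin// muleC.
have mv : measurable_fun (`[u, +oo[ : set R) (fun s => (v s)%:E).
  apply/measurable_EFinP; apply: measurable_funS (measurable_condC_abs Hw) => //.
  by move=> x /=; rewrite !in_itv/= !andbT; exact: le_trans.
have mv' : measurable_fun (`]u, +oo[ : set R) (fun s => (v s)%:E).
  apply: measurable_funS mv => // x /=.
  by rewrite !in_itv/= !andbT => /ltW.
rewrite ge0_integralZl_EFin//.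
rewrite integral_itv_obnd_cbnd// (integral_condC_abs_tail Hw)//.
by rewrite -EFinM -EFinD; congr EFin; ring.
Qed.

Lemma derive1_condC_ge0 : 0 <= derive1 w t0.
Proof.
rewrite -lee_fin -(integral_condC_abs_tail Hw (lexx _)).
by apply: integral_ge0 => s _; rewrite lee_fin normr_ge0.
Qed.

Lemma cvg_extend_at_infty :
  (w t)%:E @[t --> +oo%R] --> extend_at_infty w +oo%E /\
  (forall t, 0 <= t -> ((w t)%:E <= extend_at_infty w +oo)%E).
Proof.
(* Clamping at 0 gives a function monotone on the whole line; w is monotone only on the nonnegative
   reals. *)
pose f t := (w (Num.max t 0))%:E.
have fnd : {homo f : s t / s <= t >-> (s <= t)%E}.
  move=> s t st; rewrite lee_fin; apply: (condC_nondecreasing Hw).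
    by rewrite le_max lexx orbT.
  by rewrite ge_max !le_max st lexx !orbT.
have cw : (w t)%:E @[t --> +oo%R] --> ereal_sup (range f).
  have := nondecreasing_cvge fnd; apply: cvg_trans; apply: near_eq_cvg.
  near=> t; rewrite /f max_l//.
have wE : extend_at_infty w +oo%E = ereal_sup (range f).
  exact: cvg_lim cw.
rewrite wE; split=> // t t0'; apply: ereal_sup_ubound; exists t => //.
by rewrite /f max_l.
Unshelve. all: by end_near. Qed.

Lemma truncated_weight_pinfty :
  truncated_weight n%:R%:E @[n --> \oo] --> truncated_weight +oo%E.
Proof.
have H := @cvg_monotone_convergence _ _ _ mu `[t0, +oo[%classic _
  (fun n s => (v s)%:E * mine n%:R%:E s%:E)%E _ _ _.
have -> : (truncated_weight +oo = \int[mu]_(s in `[t0, +oo[)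
    limn (fun n : nat => (v s)%:E * mine n%:R%:E s%:E))%E.
  apply: eq_integral => s; rewrite inE/= in_itv/= andbT => ts.
  apply/esym/cvg_lim => //; apply: cvg_near_cst.
  exists (Num.bound `|s|) => // n /= sn.
  rewrite (@min_r _ _ +oo%E) ?leey// min_r// lee_fin.
  by rewrite (le_trans (ler_norm _))// (le_trans (ltW (archi_boundP _)))// ler_nat.
apply: H => //.
- by move=> n; exact: measurable_truncated_weight.
- by move=> n s; apply: truncated_weight_integrand_ge0; rewrite lee_fin.
- move=> s _ n m nm; apply: lee_wpmul2l; first by rewrite lee_fin normr_ge0.
  by rewrite le_min !ge_min lee_fin ler_nat nm lexx/= orbT.
Qed.

(** Beyond [t0] the two functions differ by a constant. Below [t0] monotonicity bounds them by their
    values w(t0) and t0 w'(t0) at [t0], whose sum is K. The case +oo is a limit of finite ones. An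
    additive constant does not affect finiteness of an expectation. *)
Lemma truncated_weight_bounds : exists K : R, 0 <= K /\
  forall u : \bar R, (0 <= u)%E ->
    (extend_at_infty w u <= truncated_weight u + K%:E)%E /\
    (truncated_weight u <= extend_at_infty w u + K%:E)%E.
Proof.
have d0 := derive1_condC_ge0.
have td0 : 0 <= t0 * derive1 w t0 by rewrite mulr_ge0// ltW.
have w0 : 0 <= w t0 by apply: (condC_ge0 Hw); exact: ltW.
pose K := w t0 + t0 * derive1 w t0.
have K0 : 0 <= K by rewrite addr_ge0.
have fin (u : R) : 0 <= u ->
    ((w u)%:E <= truncated_weight u%:E + K%:E)%E /\
    (truncated_weight u%:E <= (w u)%:E + K%:E)%E.
  move=> u0; have [tu|/ltW ut] := leP t0 u.
    by rewrite truncated_weight_fin// -!EFinD !lee_fin /K; split; lra.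
  split.
    apply: (@le_trans _ _ K%:E); last by rewrite leeDr// truncated_weight_ge0.
    have := condC_nondecreasing Hw u0 ut; rewrite lee_fin /K; lra.
  apply: (@le_trans _ _ (truncated_weight t0%:E)).
    by apply: le_truncated_weight; rewrite lee_fin.
  rewrite truncated_weight_fin// -EFinD lee_fin /K.
  have := condC_ge0 Hw u0; lra.
exists K; split=> // -[u|_|]//; first exact: fin.
have [cw wle] := cvg_extend_at_infty.
split.
  apply: (@lime_le _ _ _ _ _ (fun t => (w t)%:E)).
    by apply/cvg_ex; exists (extend_at_infty w +oo%E).
  near=> t; have t0' : 0 <= t by near: t; exact: nbhs_pinfty_ge.
  apply: (le_trans (proj1 (fin t t0'))); rewrite leeD2r//.
  by apply: le_truncated_weight; rewrite ?leey// lee_fin.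
have cT := truncated_weight_pinfty.
rewrite -(cvg_lim _ cT)//; apply: lime_le; first by apply/cvg_ex; eexists; exact: cT.
apply: nearW => n; apply: (le_trans (proj2 (fin n%:R (ler0n _ _)))).
by rewrite leeD2r// wle.
Unshelve. all: by end_near. Qed.

End TruncatedWeight.

(* Measurability is not needed: the integral of a nonnegative function is a
   supremum over the simple functions below it. *)
Lemma ge0_le_lower_integral d (T : measurableType d) (R : realType)
    (m : {measure set T -> \bar R}) (D : set T) (f g : T -> \bar R) :
  (forall x, D x -> (0 <= f x)%E) -> (forall x, D x -> (f x <= g x)%E) ->
  (\int[m]_(x in D) f x <= \int[m]_(x in D) g x)%E.
Proof.
move=> f0 fg.
rewrite !ge0_integralE//; last first.
  by move=> x Dx; apply: le_trans (fg x Dx); exact: f0.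
apply: ge_ereal_sup => _ [h /= hf <-]; apply: ereal_sup_ubound.
exists h => //= x; apply: (le_trans (hf x)).
by rewrite /patch; case: ifPn => //; rewrite inE => /fg.
Qed.

Section MomentTail.
Context {R : realType} d (T : measurableType d).
Variable Pr : probability T R.
Variables (w : R -> R) (t0 : R).
Hypothesis Hw : condition_C w t0.
Local Notation mu := (@lebesgue_measure R).
Local Notation v s := `|derive1n 2 w s|.

Variable tau : T -> \bar R.
Hypothesis mtau : measurable_fun [set: T] tau.
Hypothesis tau0 : forall omega, (0 <= tau omega)%E.

Definition truncated_mean (s : R) : \bar R :=
  (\int[Pr]_omega mine (tau omega) s%:E)%E.

Lemma truncated_mean_ge0 s : 0 <= s -> (0 <= truncated_mean s)%E.
Proof. by move=> s0; apply: integral_ge0 => x _; rewrite le_min tau0 lee_fin. Qed.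

Lemma measurable_truncation s :
  measurable_fun [set: T] (fun omega => mine (tau omega) s%:E).
Proof. exact: measurable_mine. Qed.

Lemma truncated_mean_le s : 0 <= s -> (truncated_mean s <= s%:E)%E.
Proof.
move=> s0; apply: (@le_trans _ _ (\int[Pr]_omega (cst s%:E omega))%E).
  apply: ge0_le_integral => //.
  - by move=> x _; rewrite le_min tau0 lee_fin.
  - exact: measurable_truncation.
  - by move=> x _; rewrite ge_min lexx orbT.
by rewrite integral_cst//= probability_setT mule1.
Qed.

Lemma le_truncated_mean s t : 0 <= s -> s <= t ->
  (truncated_mean s <= truncated_mean t)%E.
Proof.
move=> s0 st; apply: ge0_le_integral => //; [|exact: measurable_truncation..|].
  by move=> x _; rewrite le_min tau0 lee_fin.
by move=> x _; rewrite le_min !ge_min lexx lee_fin st/= orbT.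
Qed.

(** Tonelli's theorem is applied on the full product space, so the restriction to [t0, +oo[ is moved
    into the integrand. *)
Let k (z : T * R) : \bar R :=
  (((fun s => (v s)%:E) \_ `[t0, +oo[) z.2 * mine (tau z.1) (z.2)%:E)%E.

Let mk : measurable_fun [set: T * R] k.
Proof.
apply: emeasurable_funM.
  apply: (measurableT_comp _ measurable_snd).
  apply/(measurable_restrictT _ _).1 => //.
  by apply/measurable_EFinP; exact: measurable_condC_abs Hw.
apply: measurable_mine; first exact: (measurableT_comp mtau measurable_fst).
by apply/measurable_EFinP; exact: measurable_snd.
Qed.

Let k0 z : (0 <= k z)%E.
Proof.
rewrite /k patchE; case: ifPn => [|_]; last by rewrite mul0e.
rewrite inE/= in_itv/= andbT => tz; apply: mule_ge0 => //.
by rewrite le_min tau0 lee_fin (le_trans _ tz)// ltW// (condC_t0_gt0 Hw).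
Qed.

Let kE omega : (\int[mu]_s k (omega, s) = truncated_weight w t0 (tau omega))%E.
Proof.
rewrite /truncated_weight [RHS]integral_mkcond; apply: eq_integral => s _.
by rewrite /k !patchE/=; case: ifPn => // _; rewrite mul0e.
Qed.

Let kintE s : (\int[Pr]_omega k (omega, s) =
  ((fun s => (v s)%:E * truncated_mean s) \_ `[t0, +oo[) s)%E.
Proof.
rewrite /k patchE/= patchE; case: ifPn => sD; last first.
  by under eq_integral do rewrite mul0e; rewrite integral0.
move: sD; rewrite inE/= in_itv/= andbT => ts.
have mt := measurable_truncation s.
have tr0 x : [set: T] x -> (0 <= mine (tau x) s%:E)%E.
  by rewrite le_min tau0 lee_fin (le_trans _ ts)// ltW// (condC_t0_gt0 Hw).
by rewrite ge0_integralZl_EFin.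
Qed.

Lemma truncated_weight_tonelli :
  (\int[Pr]_omega truncated_weight w t0 (tau omega) =
   \int[mu]_(s in `[t0, +oo[) ((v s)%:E * truncated_mean s))%E.
Proof.
under eq_integral do rewrite -kE.
rewrite (@fubini_tonelli _ _ _ _ _ Pr mu k mk k0) [RHS]integral_mkcond.
by apply: eq_integral => s _; exact: kintE.
Qed.

Lemma measurable_weighted_truncated_mean :
  measurable_fun (`[t0, +oo[ : set R) (fun s => (v s)%:E * truncated_mean s)%E.
Proof.
apply/(measurable_restrictT _ _).2 => //.
have := @measurable_fun_fubini_tonelli_G _ _ _ _ _ Pr k mk k0.
congr measurable_fun; apply/funext => s; exact: kintE.
Qed.

Lemma measurable_truncated_weight_comp :
  measurable_fun [set: T] (fun omega => truncated_weight w t0 (tau omega)).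
Proof.
have := @measurable_fun_fubini_tonelli_F _ _ _ _ _ mu k mk k0; congr measurable_fun.
by apply/funext => omega; rewrite -kE.
Qed.

(** Only the truncated weight of tau is shown to be measurable. The constant K is therefore always
    added to a measurable function, and w(tau) enters only through [ge0_le_lower_integral]. *)
Lemma weight_moment_finite :
  ((\int[Pr]_omega extend_at_infty w (tau omega) < +oo)%E <->
   (\int[mu]_(s in `[t0, +oo[) ((v s)%:E * truncated_mean s) < +oo)%E).
Proof.
rewrite -truncated_weight_tonelli.
have [K [K0 HK]] := truncated_weight_bounds Hw.
have mW := measurable_truncated_weight_comp.
have W0 omega : (0 <= truncated_weight w t0 (tau omega))%E.
  exact: (truncated_weight_ge0 Hw).
have e0 omega : (0 <= extend_at_infty w (tau omega))%E.
  have := tau0 omega; case: (tau omega) => [r| |]//.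
    by rewrite !lee_fin; exact: (condC_ge0 Hw).
  move=> _; apply: le_trans (proj2 (cvg_extend_at_infty Hw) 0 (lexx _)).
  by rewrite lee_fin; exact: (condC_ge0 Hw).
split=> fin.
  (* The positive part of the truncated weight minus K lies below w(tau), and it recovers the
     truncated weight after K is added back. *)
  pose g omega := maxe (truncated_weight w t0 (tau omega) - K%:E)%E 0%E.
  have mg : measurable_fun [set: T] g.
    by apply: measurable_maxe => //; exact: emeasurable_funB.
  have g0 omega : (0 <= g omega)%E by rewrite le_max lexx orbT.
  apply: (@le_lt_trans _ _ (\int[Pr]_omega (g omega + (cst K%:E omega)))%E).
    apply: ge0_le_integral => //; first exact: emeasurable_funD.
    by move=> omega _; rewrite -leeBlDr// le_max lexx.
  rewrite ge0_integralD//.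
  rewrite integral_cst//= probability_setT mule1 lte_add_pinfty ?ltry//.
  apply: le_lt_trans fin; apply: ge0_le_lower_integral => // omega _.
  by rewrite ge_max e0 andbT leeBlDr//; have [_] := HK _ (tau0 omega).
apply: (@le_lt_trans _ _
  (\int[Pr]_omega (truncated_weight w t0 (tau omega) + (cst K%:E omega)))%E).
  apply: ge0_le_lower_integral => // omega _.
  by have [] := HK _ (tau0 omega).
rewrite ge0_integralD//.
by rewrite integral_cst//= probability_setT mule1 lte_add_pinfty ?ltry.
Qed.

Let vM0 s : t0 <= s -> (0 <= (v s)%:E * truncated_mean s)%E.
Proof.
move=> ts; apply: mule_ge0; first by rewrite lee_fin normr_ge0.
by apply: truncated_mean_ge0; rewrite (le_trans _ ts)// ltW// (condC_t0_gt0 Hw).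
Qed.

(** M(s) <= s, and s |w''(s)| has an explicit finite integral over [t0, k1]. This makes the choice
    of lower limit in [tail_integral_finite] immaterial. *)
Lemma weighted_truncated_mean_head k1 : t0 <= k1 ->
  (\int[mu]_(s in `[t0, k1]) ((v s)%:E * truncated_mean s) < +oo)%E.
Proof.
move=> tk; apply: (@le_lt_trans _ _ (\int[mu]_(s in `[t0, k1]) (s * v s)%:E)%E).
  apply: ge0_le_lower_integral => s; rewrite /= in_itv/= => /andP[ts sk].
    exact: vM0.
  rewrite mulrC EFinM lee_wpmul2l ?lee_fin ?normr_ge0// truncated_mean_le//.
  by rewrite (le_trans _ ts)// ltW// (condC_t0_gt0 Hw).
by rewrite (integral_condC_mulr_abs Hw)// ltry.
Qed.

(** The common comparison behind (2), (3) and (4): each has the form |w''| f with f within constant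
    factors of M. *)
Lemma tail_integral_finiteE (f : R -> R) (c C : R) : 0 < c ->
  (forall s, t0 <= s -> (c%:E * truncated_mean s <= (f s)%:E)%E) ->
  (forall s, t0 <= s -> ((f s)%:E <= C%:E * truncated_mean s)%E) ->
  tail_integral_finite t0 (fun s => v s * f s) <->
  (\int[mu]_(s in `[t0, +oo[) ((v s)%:E * truncated_mean s) < +oo)%E.
Proof.
move=> c0 cf fC.
have mvM := measurable_weighted_truncated_mean.
have f0 s : t0 <= s -> (0 <= (v s * f s)%:E)%E.
  move=> ts; rewrite EFinM; apply: mule_ge0; first by rewrite lee_fin normr_ge0.
  apply: le_trans (cf s ts); apply: mule_ge0; first by rewrite lee_fin ltW.
  by apply: truncated_mean_ge0; rewrite (le_trans _ ts)// ltW// (condC_t0_gt0 Hw).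
split=> [[k1 tk fin]|fin].
  have vM0k s : `[k1, +oo[%classic s -> (0 <= (v s)%:E * truncated_mean s)%E.
    by rewrite /= in_itv/= andbT => ks; apply: vM0; exact: le_trans ks.
  have mvMk : measurable_fun (`[k1, +oo[ : set R)
      (fun s => (v s)%:E * truncated_mean s)%E.
    apply: measurable_funS mvM => // s /=.
    by rewrite !in_itv/= !andbT; exact: le_trans.
  have fink : (\int[mu]_(s in `[k1, +oo[) ((v s)%:E * truncated_mean s) < +oo)%E.
    have : (\int[mu]_(s in `[k1, +oo[)
        (c%:E * ((v s)%:E * truncated_mean s)) < +oo)%E.
      apply: le_lt_trans fin; apply: ge0_le_lower_integral => s.
        by move=> ks; apply: mule_ge0; [rewrite lee_fin ltW|exact: vM0k].
      rewrite /= in_itv/= andbT => ks; rewrite muleCA EFinM.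
      rewrite lee_wpmul2l ?lee_fin ?normr_ge0// cf//; exact: le_trans ks.
    rewrite ge0_integralZl_EFin//; last exact: ltW.
    have : (0 <= \int[mu]_(s in `[k1, +oo[) ((v s)%:E * truncated_mean s))%E.
      exact: integral_ge0.
    case: (integral _ _ _) => [r _ _|_|//]; first exact: ltry.
    by rewrite gt0_muley ?lte_fin.
  have split_k : `[t0, +oo[%classic = (`[t0, k1[ `|` `[k1, +oo[ : set R).
    by apply: itv_bndbnd_setU; rewrite bnd_simp.
  rewrite split_k ge0_integral_setU//; last 3 first.
  - by rewrite -split_k.
  - by rewrite -split_k => s; rewrite /= in_itv/= andbT; exact: vM0.
  - rewrite disj_set2E; apply/eqP; apply/seteqP; split=> // x /=.
    by rewrite !in_itv/= andbT => -[/andP[_ h1]]; rewrite leNgt h1.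
  apply: lte_add_pinfty => //.
  apply: le_lt_trans (weighted_truncated_mean_head tk).
  apply: ge0_subset_integral => //.
  - apply: measurable_funS mvM => // s /=.
    by rewrite !in_itv/= andbT => /andP[].
  - by move=> s /=; rewrite in_itv/= => /andP[ts _]; exact: vM0.
  - by apply: subset_itvl; rewrite bnd_simp.
exists t0 => //.
have vM0t s : `[t0, +oo[%classic s -> (0 <= (v s)%:E * truncated_mean s)%E.
  by rewrite /= in_itv/= andbT; exact: vM0.
(* The sign of C is unknown, and scaling the integral requires a nonnegative constant. *)
pose C' := Num.max C 0.
have C'0 : 0 <= C' by rewrite le_max lexx orbT.
apply: (@le_lt_trans _ _ (\int[mu]_(s in `[t0, +oo[)
    (C'%:E * ((v s)%:E * truncated_mean s)))%E).
  apply: ge0_le_lower_integral => s; rewrite /= in_itv/= andbT => ts.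
    exact: f0.
  rewrite muleCA EFinM lee_wpmul2l ?lee_fin ?normr_ge0//.
  apply: (le_trans (fC s ts)); apply: lee_wpmul2r; last first.
    by rewrite lee_fin le_max lexx.
  by apply: truncated_mean_ge0; rewrite (le_trans _ ts)// ltW// (condC_t0_gt0 Hw).
rewrite ge0_integralZl_EFin//.
have : (0 <= \int[mu]_(s in `[t0, +oo[) ((v s)%:E * truncated_mean s))%E.
  exact: integral_ge0.
move: fin; case: (integral _ _ _) => [r _ _|//|//].
by rewrite -EFinM ltry.
Qed.

End MomentTail.

(** * Laplace transform of the return time against its truncated mean *)

Lemma expR_min_bounds (R : realType) (x : R) : 0 <= x ->
  1 <= Num.min x 1 + expR (- x) /\ 2^-1 * Num.min x 1 + expR (- x) <= 1.
Proof.
move=> x0; have e0 := expR_gt0 (- x).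
(* For x <= 1 the upper bound follows from (1 - x/2) (1 + x) >= 1; for x > 1, from 1 / (1 + x) <=
   1/2. *)
have e1 : expR (- x) * (1 + x) <= 1.
  rewrite expRN mulrC ler_pdivrMr ?expR_gt0// mul1r; exact: expR_ge1Dx.
have e2 : 1 - x <= expR (- x) by exact: expR_ge1Dx.
case: (lerP x 1) => x1; last by split; nra.
by split; nra.
Qed.

Section LaplaceTruncation.
Context {R : realType} d (T : measurableType d).
Variable Pr : probability T R.
Variable tau : T -> \bar R.
Hypothesis mtau : measurable_fun [set: T] tau.
Hypothesis tau0 : forall omega, (0 <= tau omega)%E.

Lemma measurable_expeR_opp (t : R) :
  measurable_fun [set: T] (fun omega => expeR (- (tau omega * t%:E))).
Proof.
pose A := tau @^-1` [set +oo%E].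
have mA : measurable A.
  by rewrite -[A]setTI; apply: mtau => //; exact: emeasurable_set1.
rewrite -(setUv A); apply/measurable_funU => //; first exact: measurableC.
split.
  apply: (@eq_measurable_fun _ _ _ _ _ (cst (expeR (- (+oo * t%:E))))).
    by move=> x; rewrite inE /A/= => ->.
  exact: measurable_cst.
apply: (@eq_measurable_fun _ _ _ _ _
    (EFin \o (fun x => expR (- (fine (tau x) * t))))).
  move=> x; rewrite inE /A/= => xA; have := tau0 x.
  by case: (tau x) xA => [r| |].
apply/measurable_EFinP; apply: measurable_funTS.
apply: measurableT_comp => //; apply: measurableT_comp => //.
apply: measurable_funM => //; apply: measurableT_comp => //.
Qed.

(** [expR_min_bounds] at x = tau / t, multiplied by t and integrated. Both bounds are kept as sums
    of nonnegative terms, so subtraction happens only after all values are known to be finite. *)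
Lemma laplace_truncated_mean (t : R) : 0 < t ->
  let L := fine (\int[Pr]_omega expeR (- (tau omega * (t^-1)%:E)))%E in
  ((2^-1)%:E * truncated_mean Pr tau t <= (t - t * L)%:E)%E /\
  ((t - t * L)%:E <= truncated_mean Pr tau t)%E.
Proof.
move=> t0 /=; set I := (integral _ _ _).
pose e omega := expeR (- (tau omega * (t^-1)%:E)).
have me : measurable_fun [set: T] e by exact: measurable_expeR_opp.
have e0 omega : [set: T] omega -> (0 <= e omega)%E by move=> _; exact: expeR_ge0.
have bd omega : (t%:E <= mine (tau omega) t%:E + t%:E * e omega)%E /\
   ((2^-1)%:E * mine (tau omega) t%:E + t%:E * e omega <= t%:E)%E.
  rewrite /e; have := tau0 omega; case: (tau omega) => [u| |]//.
    rewrite lee_fin => u0; have x0 : 0 <= u / t by rewrite divr_ge0// ltW.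
    have [h1 h2] := expR_min_bounds x0.
    have -> : mine u%:E t%:E = (t * Num.min (u / t) 1)%:E.
      rewrite minr_pMr ?ltW// mulr1 mulrCA divff ?lt0r_neq0// mulr1.
      by rewrite -EFin_min.
    rewrite -EFinM /= -!EFinM -!EFinD !lee_fin; split.
      by rewrite -mulrDr ler_pMr.
    by rewrite mulrCA -mulrDr ger_pMr.
  move=> _; rewrite min_r ?leey// gt0_mulye ?lte_fin ?invr_gt0//= mule0 adde0.
  by split=> //; rewrite -EFinM lee_fin; lra.
have e1 omega : (e omega <= 1)%E.
  rewrite /e -[1%E]expeR0 lee_expeR oppe_le0 mule_ge0//.
  by rewrite lee_fin invr_ge0 ltW.
have I0 : (0 <= I)%E by apply: integral_ge0.
have I1 : (I <= 1)%E.
  apply: (@le_trans _ _ (\int[Pr]_omega (cst 1 omega))%E).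
    by apply: ge0_le_integral => // omega _; exact: e1.
  by rewrite integral_cst//= probability_setT mule1.
have IE : I = (fine I)%:E.
  by rewrite fineK// ge0_fin_numE// (le_lt_trans I1)// ltry.
have mt := measurable_truncation mtau t.
have m0 omega : [set: T] omega -> (0 <= mine (tau omega) t%:E)%E.
  by move=> _; rewrite le_min tau0 lee_fin ltW.
have te0 omega : [set: T] omega -> (0 <= t%:E * e omega)%E.
  by move=> _; rewrite mule_ge0 ?e0// lee_fin ltW.
have mte : measurable_fun [set: T] (fun omega => t%:E * e omega)%E.
  exact: emeasurable_funM.
have tI : (\int[Pr]_omega (t%:E * e omega) = t%:E * I)%E.
  by rewrite ge0_integralZl_EFin// ltW.
have ct : (\int[Pr]_omega (cst t%:E omega) = t%:E)%E.
  by rewrite integral_cst//= probability_setT mule1.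
have := truncated_mean_ge0 Pr tau0 (ltW t0).
have := truncated_mean_le Pr mtau tau0 (ltW t0).
have : ((2^-1)%:E * truncated_mean Pr tau t + t%:E * I <= t%:E)%E.
  have m2 : measurable_fun [set: T] (fun x => (2^-1)%:E * mine (tau x) t%:E)%E.
    exact: emeasurable_funM.
  have m20 x : [set: T] x -> (0 <= (2^-1)%:E * mine (tau x) t%:E)%E.
    by move=> _; apply: mule_ge0; [rewrite lee_fin|exact: m0 _ Logic.I].
  rewrite -tI -[X in (_ <= X)%E]ct /truncated_mean.
  rewrite -ge0_integralZl_EFin// -ge0_integralD//.
  apply: ge0_le_integral => //.
  - by move=> omega _; apply: adde_ge0; [exact: m20 _ Logic.I|exact: te0 _ Logic.I].
  - exact: emeasurable_funD.
  - by move=> omega _; have [] := bd omega.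
have : (t%:E <= truncated_mean Pr tau t + t%:E * I)%E.
  rewrite -tI -{1}ct /truncated_mean -ge0_integralD//.
  apply: ge0_le_integral => //.
  - by move=> omega _; rewrite lee_fin ltW.
  - exact: emeasurable_funD.
  - by move=> omega _; have [] := bd omega.
rewrite IE.
case: (truncated_mean _ _ _) => [m| |]//.
by rewrite -!EFinM -!EFinD !lee_fin => h1 h2 _ _; split; lra.
Qed.
End LaplaceTruncation.

(** * The skeleton chain *)

Section CountableSplit.
Context {R : realType} d (T : measurableType d) (Pr : probability T R).

(** The two partitions may come from different maps: regeneration compares the state at step n + m
    with the state at step m. *)
Lemma countable_split (J : countType) (Y Y' : T -> J) (A B : set T) (c : R) :
  0 <= c -> measurable A -> measurable B ->
  (forall j, measurable (Y @^-1` [set j])) ->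
  (forall j, measurable (Y' @^-1` [set j])) ->
  (forall j, Pr (A `&` Y @^-1` [set j]) = c%:E * Pr (B `&` Y' @^-1` [set j]))%E ->
  (Pr A = c%:E * Pr B)%E.
Proof.
move=> c0 mA mB mY mY' AB.
have split (Z : T -> J) (C : set T) : measurable C ->
    (forall j, measurable (Z @^-1` [set j])) ->
    Pr C = (\sum_(n <oo) Pr (C `&` (pickle \o Z) @^-1` [set n]))%E /\
    (forall n, measurable (C `&` (pickle \o Z) @^-1` [set n])).
  move=> mC mZ.
  have mF n : measurable (C `&` (pickle \o Z) @^-1` [set n]).
    have [[j jn]|nj] := pselect (exists j : J, pickle j = n).
      suff -> : (pickle \o Z) @^-1` [set n] = Z @^-1` [set j].
        by apply: measurableI => //; exact: mZ.
      apply/seteqP; split=> om /=; last by move=> ->.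
      by rewrite -jn => /(pcan_inj pickleK).
    suff -> : (pickle \o Z) @^-1` [set n] = set0 by rewrite setI0.
    by apply/seteqP; split=> om //= H; apply: nj; exists (Z om).
  split=> //; rewrite -measure_semi_bigcup//; last exact: bigcupT_measurable.
  - congr (Pr _); apply/seteqP; split=> [om Com|om [n _ []]//].
    by exists (pickle (Z om)).
  - apply/trivIsetP => i j _ _ ij; apply/seteqP; split=> // om /= [[_ h1] [_ h2]].
    by move/eqP: ij; apply; rewrite -h1 -h2.
have [-> _] := split Y A mA mY; have [-> _] := split Y' B mB mY'.
rewrite -nneseriesZl//; apply: eq_eseriesr => n _.
have [[j jn]|nj] := pselect (exists j : J, pickle j = n).
  have fib (Z : T -> J) : (pickle \o Z) @^-1` [set n] = Z @^-1` [set j].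
    apply/seteqP; split=> om /=; last by move=> ->.
    by rewrite -jn => /(pcan_inj pickleK).
  by rewrite !fib AB.
have fib (Z : T -> J) : (pickle \o Z) @^-1` [set n] = set0.
  by apply/seteqP; split=> om //= H; apply: nj; exists (Z om).
by rewrite !fib !setI0 !measure0 mule0.
Qed.

End CountableSplit.

Section Skeleton.
Context {R : realType} (I : countType) (p : R -> I -> I -> R).
Context d (T : measurableType d) (P : I -> probability T R) (X : R -> T -> I).
Hypothesis Hp : honest_standard_transition_function p.
Hypothesis HX : markov_chain p P X.
Variables (x : I) (h : R).
Hypothesis h0 : 0 < h.

Local Notation Y k := (X (k%:R * h)).
Local Notation Pr := (P x).

Let kh0 k : 0 <= k%:R * h.
Proof. by rewrite mulr_ge0// ltW. Qed.

Let mY k y : measurable (Y k @^-1` [set y]).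
Proof. by apply: (chain_measurable HX); exact: kh0. Qed.

Lemma measurable_skeleton k (D : set I) : measurable (Y k @^-1` D).
Proof.
have -> : Y k @^-1` D = \bigcup_n (if unpickle n is Some y
    then (if y \in D then Y k @^-1` [set y] else set0) else set0).
  apply/seteqP; split=> [om Dom|om [n _]].
    exists (pickle (Y k om)) => //; rewrite pickleK.
    by rewrite mem_set.
  case: (unpickle n) => [y|]//; case: ifPn => //.
  by rewrite inE /= => Dy ->.
apply: bigcupT_measurable => n; case: (unpickle n) => [y|]//.
by case: ifPn.
Qed.

(** The history as one value in the countable type [seq I], so that [countable_split] can condition
    on it. *)
Let traj n (om : T) : seq I := [seq Y k om | k <- iota 0 n.+1].

Let nth_traj n om k : (k <= n)%N -> nth x (traj n om) k = Y k om.
Proof. by move=> kn; rewrite (nth_map 0)%N ?size_iota// nth_iota. Qed.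

Let traj_eq n om s : traj n om = s <->
  size s = n.+1 /\ forall k, (k <= n)%N -> Y k om = nth x s k.
Proof.
split=> [<-|[ss sk]].
  by rewrite size_map size_iota; split=> // k kn; rewrite nth_traj.
apply: (@eq_from_nth _ x); rewrite size_map size_iota// => k kn.
by rewrite nth_traj// sk.
Qed.

Let mpast n (s : nat -> I) :
  measurable [set om | forall k, (k <= n)%N -> Y k om = s k].
Proof.
have -> : [set om | forall k, (k <= n)%N -> Y k om = s k] =
    \bigcap_(k in [set k | (k <= n)%N]) (Y k @^-1` [set s k]).
  by apply/seteqP; split=> om H k kn; exact: H.
by apply: bigcap_measurable; [exists 0%N|move=> k _; exact: mY].
Qed.

Let mtraj n s : measurable (traj n @^-1` [set s]).
Proof.
have [ss|ss] := eqVneq (size s) n.+1.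
  have -> : traj n @^-1` [set s] =
      [set om | forall k, (k <= n)%N -> Y k om = nth x s k].
    by apply/seteqP; split=> om /=; rewrite traj_eq => // -[].
  exact: mpast.
suff -> : traj n @^-1` [set s] = set0 by [].
apply/seteqP; split=> om //= /traj_eq[H _].
by rewrite H eqxx in ss.
Qed.

(** The sigma-algebra generated by Y_0, ..., Y_n: as the state space is countable, a measurable set
    invariant under equality of these coordinates is a countable union of trajectory events. *)
Definition past_event n (E : set T) := measurable E /\
  forall om om', (forall k, (k <= n)%N -> Y k om = Y k om') -> E om -> E om'.

(** Splitting along the trajectories up to step n reduces the claim to [chain_markov]: each
    trajectory event lies inside E with Y_n = y or is disjoint from it. *)
Lemma past_markov n (E : set T) (y z : I) (t : R) : past_event n E -> 0 <= t ->
  (Pr (E `&` Y n @^-1` [set y] `&` X (n%:R * h + t) @^-1` [set z]) =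
   (p t y z)%:E * Pr (E `&` Y n @^-1` [set y]))%E.
Proof.
move=> [mE pE] t0.
have mXt : measurable (X (n%:R * h + t) @^-1` [set z]).
  by apply: (chain_measurable HX); rewrite addr_ge0.
apply: (@countable_split _ _ _ _ _ (traj n) (traj n)) => //.
- exact: transition_ge0 Hp _ _ _ t0.
- by apply: measurableI => //; apply: measurableI.
- by apply: measurableI.
move=> s; set past := traj n @^-1` [set s].
have mp : measurable past by exact: mtraj.
have [[om [Eom [yom som]]]|none] :=
    pselect (exists om, E om /\ Y n om = y /\ traj n om = s).
  have subE om' : past om' -> E om' /\ Y n om' = y.
    rewrite /past/= => som'.
    have Yk k : (k <= n)%N -> Y k om = Y k om'.
      by move=> kn; rewrite -(nth_traj om kn) -(nth_traj om' kn) som som'.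
    by split; [exact: pE Yk Eom|rewrite -yom Yk].
  have -> : E `&` Y n @^-1` [set y] `&` past = past.
    apply/seteqP; split=> om'; first by move=> [].
    by move=> so; have [] := subE om' so.
  have -> : E `&` Y n @^-1` [set y] `&` X (n%:R * h + t) @^-1` [set z] `&` past =
            X (n%:R * h + t) @^-1` [set z] `&` past.
    apply/seteqP; split=> om'; first by move=> [[_ ?] ?].
    by move=> [? so]; have [] := subE om' so.
  have [ss sk] := (traj_eq n om s).1 som.
  have pastE : past = [set om | forall k, (k <= n)%N -> Y k om = nth x s k].
    by apply/seteqP; split=> om' /=; rewrite /past/= traj_eq => // -[].
  (* [chain_markov] says nothing about a null trajectory, but there both sides vanish. *)
  have [P0|P0] := eqVneq (Pr past) 0%E.
    rewrite P0 mule0; apply/eqP; rewrite eq_le measure_ge0 andbT -P0.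
    by apply: le_measure; rewrite ?inE; [exact: measurableI|exact: mp|].
  have := @chain_markov _ _ _ _ _ _ _ HX x n (fun k => k%:R * h) (nth x s) t z.
  rewrite mul0r lexx => /(_ isT) /=.
  have hk k : (k < n)%N -> k%:R * h < k.+1%:R * h.
    by move=> _; rewrite ltr_pM2r// ltr_nat.
  move=> /(_ hk t0); rewrite -pastE => /(_ P0).
  rewrite -sk// yom /cond_prob => <-.
  have fpast : Pr past \is a fin_num by exact: fin_num_measure.
  have fXp : Pr (X (n%:R * h + t) @^-1` [set z] `&` past) \is a fin_num.
    by apply: fin_num_measure; apply: measurableI.
  rewrite -[in X in _ = (_ * X)%E](fineK fpast) -EFinM divfK ?fineK//.
  by rewrite fine_eq0.
have -> : E `&` Y n @^-1` [set y] `&` past = set0.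
  by apply/seteqP; split=> om // [[Eom yom] som]; apply: none; exists om.
have -> : E `&` Y n @^-1` [set y] `&` X (n%:R * h + t) @^-1` [set z] `&` past = set0.
  by apply/seteqP; split=> om // [[[Eom yom] _] som]; apply: none; exists om.
by rewrite measure0 mule0.
Qed.

End Skeleton.

(** * Regeneration at visits of x and last-exit decomposition of the skeleton *)

Section Renewal.
Context {R : realType} (I : countType) (p : R -> I -> I -> R).
Context d (T : measurableType d) (P : I -> probability T R) (X : R -> T -> I).
Hypothesis Hp : honest_standard_transition_function p.
Hypothesis HX : markov_chain p P X.
Variables (x : I) (h : R).
Hypothesis h0 : 0 < h.

Local Notation Y k := (X (k%:R * h)).
Local Notation Pr := (P x).
Local Notation past := (past_event X h).

Definition avoid n m : set T :=
  [set om | forall i, (0 < i <= m)%N -> Y (n + i) om <> x].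

Lemma measurable_avoid n m : measurable (avoid n m).
Proof.
have -> : avoid n m =
    \bigcap_(i in [set i | (0 < i <= m)%N]) (Y (n + i) @^-1` [set~ x]).
  by apply/seteqP; split=> om H k kn; exact: H.
by apply: bigcap_measurableType => k _; exact: (measurable_skeleton HX h0).
Qed.

Let kh0 k : 0 <= k%:R * h.
Proof. by rewrite mulr_ge0// ltW. Qed.

Let mY k y : measurable (Y k @^-1` [set y]).
Proof. exact: (measurable_skeleton HX h0). Qed.

Lemma past_event_visit n m (E : set T) : past n E ->
  past (n + m) (E `&` Y n @^-1` [set x] `&` avoid n m.-1).
Proof.
move=> [mE pE]; split.
  by apply: measurableI; [apply: measurableI|exact: measurable_avoid].
move=> om om' agr [[Eom xom] aom]; split; first split.
- by apply: pE Eom => k kn; apply: agr; exact: leq_trans (leq_addr _ _).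
- by rewrite /= -agr// leq_addr.
- move=> i /andP[i0 im]; rewrite -agr; first by apply: aom; rewrite i0.
  by rewrite leq_add2l (leq_trans im)// leq_pred.
Qed.

(** For n = 0 and E full, its probability is the m-step taboo probability from x to z with taboo
    state x. The predecessor leaves the last step free, so that z may be x; for m = 0 nothing is
    avoided. *)
Let G n (E : set T) m z :=
  E `&` Y n @^-1` [set x] `&` avoid n m.-1 `&` Y (n + m) @^-1` [set z].

Let mG n E m z : past n E -> measurable (G n E m z).
Proof. by move=> pE; apply: measurableI => //; case: (past_event_visit m pE). Qed.

Let visit_avoid n (E : set T) m y :
  E `&` Y n @^-1` [set x] `&` avoid n m `&` Y (n + m) @^-1` [set y] =
  if (0 < m)%N && (y == x) then set0 else G n E m y.
Proof.
case: ifPn => [/andP[m0 /eqP ->]|].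
  by apply/seteqP; split=> om // [[_ a] /= xm]; apply: (a m) => //; by rewrite m0 leqnn.
move=> my; apply/seteqP; split=> om [[Ex a] ym]; split=> //; split=> // i.
  by move=> /andP[i0 im]; apply: a; rewrite i0 (leq_trans im)// leq_pred.
move=> /andP[i0]; rewrite leq_eqVlt => /orP[/eqP im|im].
  move: my; rewrite -im i0/= => /eqP yx; rewrite im.
  by move: ym => /= ->.
by apply: a; rewrite i0/= -ltnS prednK// (leq_ltn_trans _ im).
Qed.

(** One-step recursion for taboo probabilities, by the state before last. That state may be x only
    when m = 0, that is, at the start. *)
Let step n (E : set T) m y z : past n E ->
  (Pr (G n E m.+1 z `&` Y (n + m) @^-1` [set y]) =
  if (0 < m)%N && (y == x) then 0 else (p h y z)%:E * Pr (G n E m y))%E.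
Proof.
move=> pE.
have -> : G n E m.+1 z `&` Y (n + m) @^-1` [set y] =
   (E `&` Y n @^-1` [set x] `&` avoid n m `&` Y (n + m) @^-1` [set y])
     `&` Y (n + m.+1) @^-1` [set z].
  by rewrite /G/= -!setIA (setIC (Y (n + m) @^-1` _)).
rewrite visit_avoid; case: ifPn => _; first by rewrite set0I measure0.
have hE : (n + m.+1)%:R * h = (n + m)%:R * h + h.
  by rewrite addnS -natr1 mulrDl mul1r.
rewrite hE.
exact: (past_markov Hp HX x h0 y z (past_event_visit m pE) (ltW h0)).
Qed.

Let pastT : past 0 setT.
Proof. by split. Qed.

Let visit0 : Pr (setT `&` Y 0 @^-1` [set x]) = 1%E.
Proof. by rewrite setTI mul0r (chain_start HX). Qed.

Lemma visit_fin n (E : set T) : past n E ->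
  Pr (E `&` Y n @^-1` [set x]) \is a fin_num.
Proof. by move=> [mE _]; apply: fin_num_measure; exact: measurableI. Qed.

(** Both sides obey the recursion [step], whose coefficients do not depend on n or E. Keeping the
    final state z in the claim is what closes the induction on m. *)
Let regeneration_state n (E : set T) m z : past n E ->
  (Pr (G n E m z) = Pr (E `&` Y n @^-1` [set x]) * Pr (G 0 setT m z))%E.
Proof.
move=> pE; rewrite -(fineK (visit_fin pE)).
set c := fine _; have c0 : 0 <= c by exact: fine_ge0.
elim: m z => [z|m IH z].
  have G0 k (D : set T) : G k D 0 z =
      if z == x then D `&` Y k @^-1` [set x] else set0.
    rewrite /G addn0; case: eqVneq => [->|zx].
      apply/seteqP; split=> om; first by move=> [[? ?] ?].
      by move=> [? ?]; split=> //; split=> // i; rewrite /= leqn0 lt0n andNb.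
    by apply/seteqP; split=> om // [[[_ /= ->] _] xz]; move: zx; rewrite xz eqxx.
  rewrite !G0; case: ifPn => _; last by rewrite measure0 mule0.
  by rewrite visit0 mule1 /c fineK// visit_fin.
apply: (@countable_split _ _ _ _ _ (Y (n + m)) (Y m)) => //; try exact: mG.
move=> y; rewrite step// (step m y z pastT); case: ifPn => _; first by rewrite mule0.
by rewrite IH muleCA.
Qed.

Lemma regeneration n (E : set T) m : past n E ->
  (Pr (E `&` Y n @^-1` [set x] `&` avoid n m) =
   Pr (E `&` Y n @^-1` [set x]) * Pr (setT `&` Y 0 @^-1` [set x] `&` avoid 0 m))%E.
Proof.
move=> pE; rewrite -(fineK (visit_fin pE)).
apply: (@countable_split _ _ _ _ _ (Y (n + m)) (Y m)) => //.
- exact: fine_ge0.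
- apply: measurableI; last exact: measurable_avoid.
  by case: pE => mE _; exact: measurableI.
- by apply: measurableI; [exact: measurableI|exact: measurable_avoid].
move=> y; rewrite visit_avoid (visit_avoid 0 setT); case: ifPn => _.
  by rewrite measure0 mule0.
by rewrite regeneration_state// fineK// visit_fin.
Qed.

Definition avoid_prob m : R := fine (Pr (setT `&` Y 0 @^-1` [set x] `&` avoid 0 m)).

Let avoid_probE m :
  Pr (setT `&` Y 0 @^-1` [set x] `&` avoid 0 m) = (avoid_prob m)%:E.
Proof.
rewrite fineK//; apply: fin_num_measure.
by apply: measurableI; [exact: measurableI|exact: measurable_avoid].
Qed.

Lemma avoid_prob_ge0 m : 0 <= avoid_prob m.
Proof. exact: fine_ge0. Qed.

Lemma past_eventW n m E : (n <= m)%N -> past n E -> past m E.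
Proof.
move=> nm [mE pE]; split=> // om om' agr; apply: pE => k kn.
by apply: agr; exact: leq_trans nm.
Qed.

Let E0 : set T := setT `&` Y 0 @^-1` [set x].

Let pastE0 : past 0 E0.
Proof.
split; first exact: measurableI.
by move=> om om' agr [_ H]; split=> //=; rewrite -agr.
Qed.

(** Exactly one k <= m is the time of the last visit to x up to step m, since Y_0 = x almost surely;
    regeneration at k gives the product. *)
Lemma last_exit m :
  \sum_(k < m.+1) p (k%:R * h) x x * avoid_prob (m - k) = 1.
Proof.
pose F k := E0 `&` Y k @^-1` [set x] `&` avoid k (m - k).
have mF k : measurable (F k).
  apply: measurableI; last exact: measurable_avoid.
  by apply: measurableI => //; exact: (pastE0.1).
have tF : trivIset [set: 'I_m.+1] (fun k : 'I_m.+1 => F k).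
  apply/trivIsetP => i j _ _; wlog ij : i j / (i < j)%N.
    move=> H ij; have [lij|lij|/val_inj eij] := ltngtP i j.
    - exact: H.
    - by rewrite setIC; apply: H => //; rewrite eq_sym.
    - by rewrite eij eqxx in ij.
  move=> _; apply/seteqP; split=> // om [[_ a] [[_ /= xj] _]].
  apply: (a (j - i)%N); rewrite ?subnKC ?(ltnW ij)//.
  by rewrite subn_gt0 ij/= leq_sub2r// -ltnS.
have UF : \big[setU/set0]_(k < m.+1) F k = E0.
  rewrite -bigcup_mkord; apply/seteqP; split=> [om [k _ [[]]]//|om E0om].
  have ex : exists k, (k <= m)%N && (Y k om == x).
    by exists 0%N; case: E0om => _ /= ->; rewrite eqxx.
  have bd k : (k <= m)%N && (Y k om == x) -> (k <= m)%N by case/andP.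
  have [k /andP[km /eqP xk] kmax] := ex_maxnP ex bd.
  exists k => //=; split=> // i /andP[i0 im] xi.
  have := kmax (k + i)%N; rewrite xi eqxx andbT -leq_subRL// im => /(_ isT).
  by rewrite -{2}[k]addn0 leq_add2l leqNgt i0.
apply: EFin_inj; rewrite -sumEFin -visit0 -/E0 -UF measure_bigsetU_ord//.
apply: eq_bigr => k _; apply/esym.
apply: (etrans (regeneration (m - k) (past_eventW (leq0n k) pastE0))).
rewrite avoid_probE EFinM; congr (_ * _)%E.
have := past_markov Hp HX x h0 x x pastT (kh0 k).
by rewrite -/E0 [0%:R * h]mul0r add0r visit0 mule1.
Qed.

(** The skeleton counterpart of tau <= j h. A departure must be seen before a visit counts, because
    tau ignores the initial sojourn at x. *)
Definition return_event j : set T :=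
  [set om | exists i k, [/\ (i < k <= j)%N, Y i om <> x & Y k om = x]].

Lemma measurable_return_event j : measurable (return_event j).
Proof.
have -> : return_event j = \bigcup_k \bigcup_i
    (if (i < k <= j)%N then Y i @^-1` [set~ x] `&` Y k @^-1` [set x] else set0).
  apply/seteqP; split=> [om [i [k [ik xi xk]]]|om [k _ [i _]]].
    by exists k => //; exists i => //; rewrite ik.
  by case: ifPn => // ik [xi xk]; exists i, k.
apply: bigcupT_measurable => k; apply: bigcupT_measurable => i.
case: ifPn => // _; apply: measurableI => //.
exact: (measurable_skeleton HX h0).
Qed.

Let C i : set T := [set om | forall l, (l <= i)%N -> Y l om = x].

Let pastC i : past i (C i).
Proof.
split.
  have -> : C i = \bigcap_(l in [set l | (l <= i)%N]) (Y l @^-1` [set x]).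
    by apply/seteqP; split=> om H k kn; exact: H.
  by apply: bigcap_measurableType => k _; exact: mY.
by move=> om om' agr H l li /=; rewrite -agr// H.
Qed.

Let probC i : Pr (C i `&` Y i @^-1` [set x]) = ((p h x x) ^+ i)%:E.
Proof.
have CE j : C j = C j `&` Y j @^-1` [set x].
  by apply/seteqP; split=> om; [move=> H; split=> //; exact: H|case].
elim: i => [|i IH].
  rewrite expr0 -visit0; congr (Pr _); apply/seteqP; split=> om [_ xom]; split=> //.
  by move=> l; rewrite leqn0 => /eqP ->.
have -> : C i.+1 `&` Y i.+1 @^-1` [set x] =
    C i `&` Y i @^-1` [set x] `&` X (i%:R * h + h) @^-1` [set x].
  rewrite -CE; have -> : i%:R * h + h = i.+1%:R * h by rewrite -natr1 mulrDl mul1r.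
  rewrite -CE; apply/seteqP; split=> om.
    by move=> H; split=> [l li|]; apply: H => //; exact: leqW.
  move=> [Ci xi] l; rewrite leq_eqVlt => /orP[/eqP ->//|]; rewrite ltnS; exact: Ci.
by rewrite (past_markov Hp HX x h0 x x (pastC i) (ltW h0)) IH -EFinM exprS.
Qed.

Definition no_return_prob j : R := fine (Pr (E0 `\` return_event j)).

(** Split by the last step i of the initial stay at x: having stayed through step i, with
    probability p(h, x, x)^i, the chain must avoid x for the remaining j - i steps. *)
Lemma no_return_probE j : no_return_prob j =
  \sum_(i < j.+1) p h x x ^+ i * avoid_prob (j - i).
Proof.
pose F k := C k `&` Y k @^-1` [set x] `&` avoid k (j - k).
have mF k : measurable (F k).
  apply: measurableI; last exact: measurable_avoid.
  by apply: measurableI => //; exact: (pastC k).1.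
have tF : trivIset [set: 'I_j.+1] (fun k : 'I_j.+1 => F k).
  apply/trivIsetP => i k _ _; wlog ik : i k / (i < k)%N.
    move=> H ik; have [lik|lik|/val_inj eik] := ltngtP i k.
    - exact: H.
    - by rewrite setIC; apply: H => //; rewrite eq_sym.
    - by rewrite eik eqxx in ik.
  move=> _; apply/seteqP; split=> // om [[_ a] [[Ck _] _]].
  apply: (a 1%N); last by apply: Ck; rewrite addn1.
  by rewrite /= subn_gt0 (leq_trans ik)// -ltnS.
have UF : \big[setU/set0]_(k < j.+1) F k = E0 `\` return_event j.
  rewrite -bigcup_mkord; apply/seteqP; split=> [om [k /= kj [[Ck xk] a]]|].
    split; first by split=> //=; apply: Ck.
    move=> [i [l [/andP[il lj] xi xl]]].
    have ki : (k < i)%N by rewrite ltnNge; apply/negP => /Ck.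
    apply: (a (l - k)%N); last by rewrite subnKC// ltnW// (ltn_trans ki).
    by rewrite subn_gt0 (ltn_trans ki il)/= leq_sub2r.
  move=> om [[_ x0] nr].
  have ex : exists k, (k <= j)%N && [forall l : 'I_k.+1, Y l om == x].
    exists 0%N => /=; apply/forallP => -[l l0] /=.
    by apply/eqP; move: l0; rewrite ltnS leqn0 => /eqP ->.
  have bd k : (k <= j)%N && [forall l : 'I_k.+1, Y l om == x] -> (k <= j)%N.
    by case/andP.
  have [k /andP[kj /forallP xk] kmax] := ex_maxnP ex bd.
  have Ck l : (l <= k)%N -> Y l om = x.
    by move=> lk; apply/eqP; exact: (xk (Ordinal (lk : (l < k.+1)%N))).
  exists k => //=; split; first by split=> //=; exact: Ck.
  move=> i /andP[i0 ij] xi.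
  have kij : (k + i <= j)%N by rewrite -leq_subRL.
  have kj' : (k < j)%N by apply: leq_trans kij; rewrite -addn1 leq_add2l.
  have xk1 : Y k.+1 om <> x.
    move=> xk1; have := kmax k.+1; rewrite kj' ltnn/= => H.
    suff /H : [forall l : 'I_k.+2, Y l om == x] by [].
    apply/forallP => -[l lk] /=; move: lk.
    rewrite ltnS leq_eqVlt => /orP[/eqP ->|lk]; first exact/eqP.
    by apply/eqP/Ck.
  (* A visit at step k + 1 would prolong the initial stay beyond its maximum k; a later one, after
     Y_(k+1) has left x, is a return. *)
  have [i1|i1] := eqVneq i 1%N; first by apply: xk1; rewrite -addn1 -i1.
  apply: nr; exists k.+1, (k + i)%N; split=> //.
  by rewrite kij andbT -addn1 ltn_add2l ltn_neqAle eq_sym i1.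
apply: EFin_inj; rewrite -sumEFin /no_return_prob fineK -?UF; last first.
  apply: fin_num_measure; apply: bigsetU_measurable => k _; exact: mF.
rewrite measure_bigsetU_ord//; apply: eq_bigr => k _.
apply: (etrans (regeneration (j - k) (pastC k))).
by rewrite avoid_probE probC EFinM.
Qed.

End Renewal.

(** * Partial sums of the renewal sequences *)

Section RenewalSequences.
Context {R : realType}.
Variables (u r b : nat -> R) (a : R).
Hypotheses (u0 : forall k, 0 <= u k) (r0 : forall k, 0 <= r k).
Hypotheses (b0 : forall k, 0 <= b k) (a01 : 0 <= a <= 1).
Hypothesis b_noninc : forall j k, (j <= k)%N -> b k <= b j.
Hypothesis ur1 : forall m, \sum_(k < m.+1) u k * r (m - k) = 1.
Hypothesis bE : forall j, b j = \sum_(i < j.+1) a ^+ i * r (j - i).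

(** The sum of the identities [ur1] over m < M, regrouped by k. *)
Let triangle M : \sum_(k < M) u k * (\sum_(j < M - k) r j) = M%:R.
Proof.
elim: M => [|M IH]; first by rewrite big_ord0.
rewrite -natr1 -IH -(ur1 M) !big_ord_recr/= subSnn big_ord1 subnn addrA.
congr (_ + _); rewrite -big_split/=; apply: eq_bigr => k _.
by rewrite -mulrDr subSn ?big_ord_recr//= ltnW.
Qed.

Let sum_le n m (f : nat -> R) : (forall k, 0 <= f k) -> (n <= m)%N ->
  \sum_(j < n) f j <= \sum_(j < m) f j.
Proof.
move=> f0 /subnKC <-; rewrite big_split_ord/= lerDl; exact: sumr_ge0.
Qed.

Let UV_ge N : N%:R <= (\sum_(k < N) u k) * (\sum_(j < N) r j).
Proof.
rewrite -[leLHS]triangle mulr_suml; apply: ler_sum => k _.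
by apply: ler_wpM2l => //; apply: sum_le => //; exact: leq_subr.
Qed.

(** The square of pairs k, j < N lies in the triangle k + j < 2 N, whence the factor 2; [UV_ge] uses
    that it contains the triangle k + j < N. *)
Let UV_le N : (\sum_(k < N) u k) * (\sum_(j < N) r j) <= 2 * N%:R.
Proof.
have -> : 2 * N%:R = (N + N)%:R :> R by rewrite natrD; ring.
rewrite -triangle mulr_suml.
apply: (@le_trans _ _ (\sum_(k < N) u k * (\sum_(j < N + N - k) r j))).
  apply: ler_sum => k _; apply: ler_wpM2l => //; apply: sum_le => //.
  by rewrite -addnBA ?leq_addr// ltnW.
rewrite [leRHS]big_split_ord/= lerDl; apply: sumr_ge0 => k _.
by apply: mulr_ge0 => //; exact: sumr_ge0.
Qed.

(** By [bE], r_(j+1) = b_(j+1) - a b_j; summation leaves the boundary term a b_N. *)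
Let VE N : \sum_(j < N.+1) r j = (1 - a) * (\sum_(j < N.+1) b j) + a * b N.
Proof.
elim: N => [|N IH].
  by rewrite !big_ord1 bE big_ord1 expr0 mul1r subnn; ring.
rewrite big_ord_recr/= IH [in RHS]big_ord_recr/=.
have -> : b N.+1 = r N.+1 + a * b N.
  rewrite bE big_ord_recl/= expr0 mul1r subn0; congr (_ + _).
  rewrite bE mulr_sumr; apply: eq_bigr => i _.
  by rewrite /bump/= add1n exprS mulrA subSS.
ring.
Qed.

(** Since b is nonincreasing, the boundary term a b_N is at most the average of b_0, ..., b_N; this
    is the summand 1 / (N + 1). *)
Lemma renewal_sums_lower N : N.+1%:R <=
  (\sum_(k < N.+1) u k) * ((1 - a + N.+1%:R^-1) * (\sum_(j < N.+1) b j)).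
Proof.
apply: le_trans (UV_ge _) _; apply: ler_wpM2l; first exact: sumr_ge0.
rewrite VE [leRHS]mulrDl lerD2l.
apply: (@le_trans _ _ (b N)).
  by rewrite ler_piMl//; case/andP: a01.
rewrite ler_pdivlMl ?ltr0n// -[N.+1 in leLHS]card_ord -sumr_const.
rewrite mulr_suml; apply: ler_sum => j _; rewrite mul1r.
by apply: b_noninc; rewrite -ltnS.
Qed.

Lemma renewal_sums_upper N :
  (\sum_(k < N) u k) * ((1 - a) * (\sum_(j < N) b j)) <= 2 * N%:R.
Proof.
case: N => [|N]; first by rewrite !big_ord0 mul0r mulr0.
apply: le_trans (UV_le _); apply: ler_wpM2l; first exact: sumr_ge0.
by rewrite VE lerDl mulr_ge0//; case/andP: a01.
Qed.

End RenewalSequences.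

(** * Occupation time and resolvent *)

Section TransitionFunction.
Context {R : realType} (I : countType) (p : R -> I -> I -> R).
Hypothesis Hp : honest_standard_transition_function p.
Local Notation mu := (@lebesgue_measure R).

Lemma transition_esum_split (t : R) (y : I) (g : I -> R) : 0 <= t ->
  (forall z, 0 <= g z) ->
  (\esum_(z in [set: I]) (p t y z * g z)%:E =
   (p t y y * g y)%:E + \esum_(z in [set~ y]) (p t y z * g z)%:E)%E.
Proof.
move=> t0 g0; rewrite (esumID [set y]); last first.
  by move=> z _; rewrite lee_fin mulr_ge0// (transition_ge0 Hp).
by rewrite !setTI esum_set1// lee_fin mulr_ge0// (transition_ge0 Hp).
Qed.

Lemma transition_offdiag (t : R) (y : I) : 0 <= t ->
  ((p t y y)%:E + \esum_(z in [set~ y]) (p t y z)%:E = 1)%E.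
Proof.
move=> t0; rewrite -(transition_honest Hp y t0).
have := @transition_esum_split t y (fun=> 1) t0 (fun=> ler01).
rewrite mulr1; under eq_esum do rewrite mulr1.
by under [in X in _ = X -> _]eq_esum do rewrite mulr1.
Qed.

Lemma transition_diag_le1 (t : R) (y : I) : 0 <= t -> p t y y <= 1.
Proof.
move=> t0; rewrite -lee_fin -(transition_offdiag y t0) leeDl//.
by apply: esum_ge0 => z _; rewrite lee_fin (transition_ge0 Hp).
Qed.

Lemma transition_le1 (t : R) (y z : I) : 0 <= t -> p t y z <= 1.
Proof.
move=> t0; have [->|zy] := eqVneq z y; first exact: transition_diag_le1.
rewrite -lee_fin -(transition_offdiag y t0).
apply: (@le_trans _ _ (\esum_(z in [set~ y]) (p t y z)%:E)%E).
  apply: esum_ge; exists [set z]; last by rewrite fsbig_set1.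
  by split; [exact: finite_set1|move=> i ->; exact/eqP].
by rewrite leeDr// lee_fin (transition_ge0 Hp).
Qed.

(** In the Chapman-Kolmogorov sum for u + s, the term staying at x differs from p(s, x, x) by at
    most 1 - p(u, x, x), downwards, and the other terms add at most 1 - p(u, x, x). *)
Lemma transition_modulus (s u : R) (x : I) : 0 <= s -> 0 <= u ->
  `|p (s + u) x x - p s x x| <= 1 - p u x x.
Proof.
move=> s0 u0.
have := transition_chapman_kolmogorov Hp x x u0 s0.
rewrite (@transition_esum_split u x (fun z => p s z x))//; last first.
  by move=> z; exact: (transition_ge0 Hp).
have := transition_offdiag x u0.
have : (\esum_(z in [set~ x]) (p u x z * p s z x)%:E <=
        \esum_(z in [set~ x]) (p u x z)%:E)%E.
  apply: le_esum => z _; rewrite lee_fin ler_piMr//.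
    exact: (transition_ge0 Hp).
  exact: transition_le1.
have : (0 <= \esum_(z in [set~ x]) (p u x z * p s z x)%:E)%E.
  by apply: esum_ge0 => z _; rewrite lee_fin mulr_ge0// (transition_ge0 Hp).
have pu0 := transition_ge0 Hp x x u0; have pu1 := transition_diag_le1 x u0.
have ps0 := transition_ge0 Hp x x s0; have ps1 := transition_diag_le1 x s0.
rewrite [u + s]addrC.
case: (esum _ _) => [a| |]//; case: (esum _ _) => [b| |]//.
rewrite -!EFinD !lee_fin => a0 ab [bE] [->].
by rewrite ler_norml; apply/andP; split; nra.
Qed.

Lemma continuous_transition_diag (x : I) (s : R) : 0 < s ->
  {for s, continuous (fun t => p t x x)}.
Proof.
move=> s0; apply/cvgrPdist_lt => e e0.
have := @transition_standard _ _ _ Hp x x; rewrite eqxx.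
move=> /cvgrPdist_lt/(_ e e0)[d /= d0 dP].
near=> t.
have t0 : 0 < t by near: t; exact: lt_nbhsr.
have std : `|s - t| < d by near: t; exact: cvgr_dist_lt.
have modulus v w : 0 < w -> 0 < v -> `|v - w| < d -> v < w ->
    `|p w x x - p v x x| < e.
  move=> w0 v0 vwd vw; have u0 : 0 < w - v by rewrite subr_gt0.
  have := @transition_modulus v (w - v) x (ltW v0) (ltW u0).
  rewrite [v + _]addrC subrK => /le_lt_trans; apply.
  have := dP (w - v); rewrite /ball_/= sub0r normrN distrC => /(_ vwd u0).
  by rewrite ger0_norm// subr_ge0; apply: transition_diag_le1; exact: ltW.
have [st|ts|->] := ltgtP s t; last by rewrite subrr normr0.
- by rewrite distrC; exact: modulus.
- by apply: modulus => //; rewrite distrC.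
Unshelve. all: by end_near. Qed.

Lemma measurable_transition_diag (x : I) :
  measurable_fun (`[0, +oo[ : set R) (fun t => p t x x).
Proof.
(* Values of p at negative times are arbitrary, so two-sided continuity is available only on the
   open half-line, and 0 is split off. *)
have -> : `[0, +oo[%classic = ([set 0] `|` `]0, +oo[ : set R).
  by rewrite setU1itv// bnd_simp.
apply/measurable_funU => //; split; first exact: measurable_fun_set1.
apply: open_continuous_measurable_fun => //.
move=> s; rewrite inE/= in_itv/= andbT; exact: continuous_transition_diag.
Qed.

Lemma integrable_transition_diag (x : I) (a b : R) (b1 b2 : bool) : 0 <= a ->
  mu.-integrable [set` Interval (BSide b1 a) (BSide b2 b)]
    (EFin \o (fun t => p t x x)).
Proof.
move=> a0.
have sub : [set` Interval (BSide b1 a) (BSide b2 b)] `<=` `[0, +oo[.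
  apply: subset_itv; last by case: b2.
  by rewrite bnd_simp; case: b1.
apply: measurable_bounded_integrable => //.
- by rewrite /= lebesgue_measure_itv/=; case: ifP => _; rewrite -?EFinB ltry.
- exact: measurable_funS (measurable_transition_diag x).
- exists 1; split; first exact: num_real.
  move=> M M1 s /sub /=; rewrite in_itv/= andbT => s0.
  rewrite ger0_norm ?(transition_ge0 Hp)//.
  by apply: le_trans (ltW M1); exact: transition_diag_le1.
Qed.

End TransitionFunction.

Section OccupationTime.
Context {R : realType} (I : countType) (p : R -> I -> I -> R).
Hypothesis Hp : honest_standard_transition_function p.
Variable x : I.
Local Notation mu := (@lebesgue_measure R).
Local Notation S t := (S_ p t x).

Lemma S_0 : S 0 = 0.
Proof. by rewrite /S_ set_itv1 Rintegral_set1. Qed.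

Lemma S_increment (a b : R) : 0 <= a -> a <= b ->
  S b - S a = \int[mu]_(s in `]a, b]) p s x x.
Proof.
move=> a0 ab; apply: Rintegral_itvB; rewrite ?bnd_simp//.
exact: integrable_transition_diag.
Qed.

Lemma S_increment_bounds (a b m M : R) : 0 <= a -> a <= b ->
  (forall s, a < s <= b -> m <= p s x x <= M) ->
  m * (b - a) <= S b - S a <= M * (b - a).
Proof.
move=> a0 ab mM; rewrite S_increment//.
have ip := integrable_transition_diag Hp x b false false a0.
have cst_int (c : R) : \int[mu]_(s in `]a, b]) cst c s = c * (b - a).
  rewrite Rintegral_cst//= lebesgue_measure_itv/= lte_fin.
  case: ltP => // ba; have -> : b - a = 0 by apply/eqP; rewrite subr_eq0 eq_le ba ab.
  by rewrite mulr0.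
have ic (c : R) : mu.-integrable `]a, b] (EFin \o cst c).
  apply: measurable_bounded_integrable => //.
    by rewrite /= lebesgue_measure_itv/=; case: ifP => _; rewrite -?EFinB ltry.
  exists `|c|; split; first exact: num_real.
  by move=> N cN s _; exact: ltW.
apply/andP; split.
  rewrite -cst_int; apply: le_Rintegral => // s.
  by rewrite /= in_itv/= => /mM /andP[].
rewrite -(cst_int M); apply: le_Rintegral => // s.
by rewrite /= in_itv/= => /mM /andP[].
Qed.

Lemma le_S (a b : R) : 0 <= a -> a <= b -> S a <= S b.
Proof.
move=> a0 ab; rewrite -subr_ge0.
have := @S_increment_bounds a b 0 1 a0 ab; rewrite mul0r => H.
apply: (proj1 (andP (H _))) => s /andP[as_ _].
have s0 : 0 <= s by rewrite (le_trans a0)// ltW.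
by rewrite (transition_ge0 Hp)// (transition_diag_le1 Hp).
Qed.

Lemma S_ge0 (a : R) : 0 <= a -> 0 <= S a.
Proof. by move=> a0; rewrite -S_0; exact: le_S. Qed.

Lemma S_riemann (h e : R) n : 0 < h ->
  (forall s u, 0 <= s -> 0 <= u <= h -> `|p (s + u) x x - p s x x| <= e) ->
  `|h * (\sum_(k < n) p (k%:R * h) x x) - S (n%:R * h)| <= n%:R * h * e.
Proof.
move=> h0 he; elim: n => [|n IH].
  by rewrite big_ord0 mulr0 mul0r S_0 subr0 normr0 mul0r.
have nh : 0 <= n%:R * h by rewrite mulr_ge0// ltW.
have nh1 : n%:R * h <= n.+1%:R * h by rewrite ler_pM2r// ler_nat.
have pb s : n%:R * h < s <= n.+1%:R * h ->
    p (n%:R * h) x x - e <= p s x x <= p (n%:R * h) x x + e.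
  move=> /andP[ns sn]; have sh : 0 <= s - n%:R * h <= h.
    by apply/andP; split; move: ns sn; rewrite -natr1 mulrDl mul1r; lra.
  have := he _ _ nh sh.
  by rewrite [_ + (s - _)]addrC subrK ler_norml => /andP[]; lra.
have /andP[h1 h2] := S_increment_bounds nh nh1 pb.
have hE : n.+1%:R * h - n%:R * h = h by rewrite -mulrBl -natrB// subSnn mul1r.
rewrite hE in h1 h2.
rewrite big_ord_recr/= mulrDr; move: IH; rewrite !ler_norml => /andP[i1 i2].
have -> : n.+1%:R * h * e = n%:R * h * e + h * e by rewrite -natr1; ring.
by apply/andP; split; lra.
Qed.

(** [transition_modulus] is uniform in s, so one mesh serves all blocks; an error e / t per unit of
    time adds up to e. *)
Lemma S_riemann_cvg (t : R) : 0 < t ->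
  (t / n.+1%:R) * (\sum_(k < n.+1) p (k%:R * (t / n.+1%:R)) x x) @[n --> \oo]
    --> S t.
Proof.
move=> t0; apply/cvgrPdist_le => e e0.
have et0 : 0 < e / t by rewrite divr_gt0.
have := @transition_standard _ _ _ Hp x x; rewrite eqxx.
move=> /cvgrPdist_lt/(_ _ et0)[d /= d0 dP].
have dt0 : 0 < d / t by rewrite divr_gt0.
near=> n.
have h0 : 0 < t / n.+1%:R by rewrite divr_gt0.
have hd : t / n.+1%:R < d.
  rewrite mulrC -ltr_pdivlMr//; near: n.
  exact: (@near_infty_natSinv_lt R (PosNum dt0)).
have nh : n.+1%:R * (t / n.+1%:R) = t by rewrite mulrC divfK.
have := @S_riemann (t / n.+1%:R) (e / t) n.+1 h0.
rewrite nh distrC mulrCA divff ?lt0r_neq0// mulr1; apply.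
move=> s u s0 /andP[u0 uh].
have [->|un0] := eqVneq u 0; first by rewrite addr0 subrr normr0 ltW.
have u0' : 0 < u by rewrite lt_neqAle eq_sym un0.
apply: (le_trans (transition_modulus Hp x s0 u0)).
have := dP u; rewrite /ball_/= sub0r normrN ger0_norm// => /(_ _ u0').
rewrite (le_lt_trans uh hd) => /(_ isT).
rewrite ger0_norm ?subr_ge0 ?(transition_diag_le1 Hp)//; exact: ltW.
Unshelve. all: by end_near. Qed.

End OccupationTime.

Lemma expRN_nat_le (R : realType) n : expR (- n%:R) <= (2 ^+ n)^-1 :> R.
Proof.
rewrite expRN lef_pV2 ?posrE ?expR_gt0 ?exprn_gt0//.
rewrite -[n%:R]mul1r mulrC expRM_natl; apply: lerXn2r; rewrite ?nnegrE ?expR_ge0//.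
exact: (expR_ge1Dx 1).
Qed.

Section Resolvent.
Context {R : realType} (I : countType) (p : R -> I -> I -> R).
Hypothesis Hp : honest_standard_transition_function p.
Variable x : I.
Local Notation mu := (@lebesgue_measure R).
Local Notation S t := (S_ p t x).
Variable t : R.
Hypothesis t0 : 0 < t.

Let g s := expR (- (1 / t * s)) * p s x x.

Let g0 s : 0 <= s -> 0 <= g s.
Proof. by move=> s0; rewrite mulr_ge0 ?expR_ge0// (transition_ge0 Hp). Qed.

Let mg (D : set R) : D `<=` `[0, +oo[ -> measurable D -> measurable_fun D g.
Proof.
move=> sD mD; apply: measurable_funM.
  apply: measurable_funTS; apply: measurableT_comp => //.
  by apply: measurableT_comp => //; apply: measurable_funM.
exact: measurable_funS (measurable_transition_diag Hp x).
Qed.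

Let mgE (D : set R) : D `<=` `[0, +oo[ -> measurable D ->
  measurable_fun D (EFin \o g).
Proof. by move=> sD mD; apply/measurable_EFinP; exact: mg. Qed.

Let S_E (a b : R) : 0 <= a -> a <= b ->
  (\int[mu]_(s in `]a, b]) (p s x x)%:E = (S b - S a)%:E)%E.
Proof.
move=> a0 ab; rewrite (S_increment Hp)// /Rintegral fineK//.
by apply: integrable_fin_num => //; exact: integrable_transition_diag.
Qed.

Let p0E (D : set R) : D `<=` `[0, +oo[ ->
  forall s, D s -> (0 <= (p s x x)%:E)%E.
Proof.
move=> sD s /sD; rewrite /= in_itv/= andbT => s0.
by rewrite lee_fin (transition_ge0 Hp).
Qed.

Let mpE (D : set R) : D `<=` `[0, +oo[ -> measurable D ->
  measurable_fun D (EFin \o (fun s => p s x x)).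
Proof.
move=> sD mD; apply/measurable_EFinP.
exact: measurable_funS (measurable_transition_diag Hp x).
Qed.

Let g0E (D : set R) : D `<=` `[0, +oo[ ->
  forall s, D s -> (0 <= (g s)%:E)%E.
Proof. by move=> sD s /sD; rewrite /= in_itv/= andbT lee_fin; exact: g0. Qed.

Let sub_oc (a b : R) : 0 <= a -> `]a, b] `<=` (`[0, +oo[ : set R).
Proof.
move=> a0 s; rewrite /= !in_itv/= andbT => /andP[as_ _].
by rewrite (le_trans a0)// ltW.
Qed.

Let block_le (a b : R) : 0 <= a -> a <= b ->
  (\int[mu]_(s in `]a, b]) (g s)%:E <=
   (expR (- (1 / t * a)) * (S b - S a))%:E)%E.
Proof.
move=> a0 ab; have sD := @sub_oc a b a0.
rewrite EFinM -S_E//.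
rewrite -ge0_integralZl_EFin ?expR_ge0//; [|exact: p0E|exact: mpE].
apply: ge0_le_lower_integral => s sab; first exact: g0E sab.
move: (sab); rewrite /= in_itv/= => /andP[as_ _].
rewrite -EFinM lee_fin ler_wpM2r//.
  by apply: (transition_ge0 Hp); rewrite (le_trans a0)// ltW.
by rewrite ler_expR lerN2 ler_wpM2l ?divr_ge0// ltW.
Qed.

Let block_ge (a b : R) : 0 <= a -> a <= b ->
  ((expR (- (1 / t * b)) * (S b - S a))%:E <=
   \int[mu]_(s in `]a, b]) (g s)%:E)%E.
Proof.
move=> a0 ab; have sD := @sub_oc a b a0.
rewrite EFinM -S_E//.
rewrite -ge0_integralZl_EFin ?expR_ge0//; [|exact: p0E|exact: mpE].
apply: ge0_le_lower_integral => s sab.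
  by apply: mule_ge0; [rewrite lee_fin expR_ge0|exact: p0E sab].
move: (sab); rewrite /= in_itv/= => /andP[as_ sb].
rewrite -EFinM lee_fin ler_wpM2r//.
  by apply: (transition_ge0 Hp); rewrite (le_trans a0)// ltW.
by rewrite ler_expR lerN2 ler_wpM2l ?divr_ge0// ltW.
Qed.

Let sub_cc (b : R) : `[0, b] `<=` (`[0, +oo[ : set R).
Proof. by move=> s; rewrite /= !in_itv/= andbT => /andP[]. Qed.

(* 4 - (2 n + 4) / 2 ^ n is the sum of (k + 1) / 2 ^ k over k < n. *)
Let head_le (K : R) : 0 <= K ->
  (forall n : nat, S (n.+1%:R * t) <= n.+1%:R * K * S t) ->
  forall n : nat, (\int[mu]_(s in `[0%R, (n%:R * t)%R]) (g s)%:E <=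
   ((4 - (2 * n%:R + 4) / 2 ^+ n) * (K * S t))%:E)%E.
Proof.
move=> K0 HK; elim=> [|n IH].
  rewrite mul0r set_itv1 integral_set1 expr0 mulr0 add0r divr1 subrr mul0r.
  exact: lexx.
have nt0 : 0 <= n%:R * t by rewrite mulr_ge0// ltW.
have nt1 : n%:R * t <= n.+1%:R * t by rewrite ler_pM2r// ler_nat.
have splitE : `[0, n.+1%:R * t]%classic =
    (`[0, n%:R * t] `|` `]n%:R * t, n.+1%:R * t] : set R).
  by apply: itv_bndbnd_setU; rewrite bnd_simp.
have mgn := mgE (@sub_cc (n.+1%:R * t)) (measurable_itv _).
have gn0 := g0E (@sub_cc (n.+1%:R * t)).
rewrite splitE in mgn gn0 *.
rewrite ge0_integral_setU//; last first.
  rewrite disj_set2E; apply/eqP; apply/seteqP; split=> // s /=.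
  by rewrite !in_itv/= => -[/andP[_ h1]] /andP[h2 _]; move: h1; rewrite leNgt h2.
apply: (le_trans (leeD IH (block_le nt0 nt1))).
rewrite -EFinD lee_fin.
have St0 : 0 <= S t by apply: (S_ge0 Hp); exact: ltW.
have e2 : expR (- (1 / t * (n%:R * t))) <= (2 ^+ n)^-1.
  have -> : 1 / t * (n%:R * t) = n%:R by rewrite mul1r mulrCA mulVf ?mulr1// lt0r_neq0.
  exact: expRN_nat_le.
have Sn : S (n.+1%:R * t) - S (n%:R * t) <= n.+1%:R * K * S t.
  by rewrite (le_trans _ (HK n))// gerBl (S_ge0 Hp).
have Sn0 : 0 <= S (n.+1%:R * t) - S (n%:R * t) by rewrite subr_ge0 (le_S Hp).
have := ler_pM (expR_ge0 _) Sn0 e2 Sn.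
have z0 : (0 : R) < 2 ^+ n by rewrite exprn_gt0.
move=> H; apply: (le_trans (lerD (lexx _) H)).
rewrite le_eqVlt; apply/orP; left; apply/eqP.
rewrite exprS -natr1; field.
exact: lt0r_neq0.
Qed.

(** On the block from n t to (n + 1) t the weight is at most e^(-n) <= 2^(-n) and the occupation at
    most (n + 1) K S_t; the sum of (n + 1) / 2^n is 4. The lower bound keeps only [0, t], where the
    weight is at least 1/e. *)
Lemma resolvent_bounds (K : R) : 0 <= K ->
  (forall n : nat, S (n.+1%:R * t) <= n.+1%:R * K * S t) ->
  expR (- 1) * S t <= G_ p (1 / t) x <= 4 * (K * S t).
Proof.
move=> K0 HK.
have St0 : 0 <= S t by apply: (S_ge0 Hp); exact: ltW.
have KS0 : 0 <= K * S t by exact: mulr_ge0.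
have id_oo := @subset_refl _ (`[0, +oo[%classic : set R).
have mgoo := mgE id_oo (measurable_itv _).
have upper : (\int[mu]_(s in `[0%R, +oo[) (g s)%:E <= (4 * (K * S t))%:E)%E.
  have cover : (`[0, +oo[%classic : set R) = \bigcup_n `[0, n%:R * t]%classic.
    apply/seteqP; split=> [s|s [n _]]; last exact: sub_cc.
    rewrite /= in_itv/= andbT => s0; exists (Num.bound (s / t)) => //=.
    rewrite in_itv/= s0/= -ler_pdivrMr//; apply/ltW/archi_boundP.
    by rewrite divr_ge0// ltW.
  have cvgJ : (\int[mu]_(s in `[0%R, (n%:R * t)%R]) (g s)%:E)%E @[n --> \oo]
      --> (\int[mu]_(s in `[0%R, +oo[) (g s)%:E)%E.
    rewrite cover; apply: ge0_nondecreasing_set_cvg_integral => //.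
    - move=> n m nm; apply/subsetPset; apply: subset_itvl.
      by rewrite bnd_simp ler_pM2r// ler_nat.
    - by move=> n; apply: mgE => //; exact: sub_cc.
    - by move=> n s; apply: g0E; exact: sub_cc.
  rewrite -(cvg_lim _ cvgJ)//; apply: lime_le.
    by apply/cvg_ex; eexists; exact: cvgJ.
  apply: nearW => n; apply: (le_trans (head_le K0 HK n)).
  rewrite lee_fin ler_wpM2r// gerBl; apply: divr_ge0; last exact: exprn_ge0.
  by apply: addr_ge0 => //; exact: mulr_ge0.
have lower : ((expR (- 1) * S t)%:E <= \int[mu]_(s in `[0%R, +oo[) (g s)%:E)%E.
  have := block_ge (lexx 0) (ltW t0).
  rewrite mul1r mulVf ?lt0r_neq0// (S_0 p x) subr0 => /le_trans; apply.
  apply: ge0_subset_integral => //.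
    by move=> s; apply: g0E.
  exact: sub_oc.
(* [G_] takes the real part of an extended integral, which agrees with it once the upper bound shows
   finiteness. *)
have GE : (G_ p (1 / t) x)%:E = (\int[mu]_(s in `[0%R, +oo[) (g s)%:E)%E.
  rewrite /G_ /Rintegral fineK// ge0_fin_numE ?(le_lt_trans upper) ?ltry//.
  apply: le_trans lower; rewrite lee_fin mulr_ge0 ?expR_ge0//.
by rewrite -!lee_fin GE lower.
Qed.

End Resolvent.

(** * The return time as a limit of skeleton return times *)

(** The sum is the first index where b fails, capped at N. It writes the first return step as a sum
    of indicators, whose expectation is a sum of probabilities. *)
Lemma sum_noninc_bool (b : nat -> bool) (N : nat) :
  (forall j k, (j <= k)%N -> b k -> b j) ->
  ((\sum_(j < N) b j < N -> ~~ b (\sum_(j < N) b j))%N /\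
   (forall k, ~~ b k -> \sum_(j < N) b j <= k)%N).
Proof.
move=> bd; split.
  set c := (\sum_(j < N) b j)%N => cN; apply/negP => bc.
  have : (c.+1 <= c)%N.
    rewrite {2}/c -(subnKC cN) big_split_ord/=.
    apply: (@leq_trans (\sum_(j < c.+1) 1)%N); first by rewrite sum1_card card_ord.
    apply: (@leq_trans (\sum_(j < c.+1) b j)%N); last exact: leq_addr.
    by apply: leq_sum => j _; rewrite (bd j c)// -ltnS.
  by rewrite ltnn.
move=> k bk; have [kN|Nk] := leqP k N; last first.
  apply: leq_trans (ltnW Nk); rewrite -[leqRHS]card_ord -sum1_card.
  by apply: leq_sum => j _; case: (b j).
rewrite -(subnKC kN) big_split_ord/= [X in (_ + X)%N]big1 ?addn0; last first.
  move=> j _; have [/(bd k (k + j)%N (leq_addr _ _))|//] := boolP (b (k + j)%N).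
  by rewrite (negbTE bk).
rewrite -[leqRHS]card_ord -sum1_card.
by apply: leq_sum => j _; case: (b j).
Qed.

Section ReturnTime.
Context {R : realType} (I : countType) (p : R -> I -> I -> R).
Context d (T : measurableType d) (P : I -> probability T R) (X : R -> T -> I).
Hypothesis HX : markov_chain p P X.
Variable x : I.
Local Notation tau := (return_time X x).

Let right_cst (t : R) om : 0 <= t ->
  exists2 e, 0 < e & forall s, t <= s < t + e -> X s om = X t om.
Proof.
move=> t0; have [e /= e0 eP] := chain_right_continuous HX om t0.
exists e => // s /andP[]; rewrite le_eqVlt => /orP[/eqP ->//|ts ste].
by apply: eP => //=; rewrite distrC ger0_norm ?subr_ge0 1?ltW// ltrBlDl.
Qed.

Lemma jump_time1_ge0 om : (0 <= jump_time X 1 om)%E.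
Proof. by apply: le_ereal_inf_tmp => _ [t /= [/ltW ? _] <-]. Qed.

Lemma jump_time1_le_return_time om : (jump_time X 1 om <= tau om)%E.
Proof. by apply: le_ereal_inf_tmp => _ [t /= [/ltW ? _] <-]. Qed.

Lemma return_time_ge0 om : (0 <= tau om)%E.
Proof. exact: le_trans (jump_time1_ge0 om) (jump_time1_le_return_time om). Qed.

(** States persist for a while to the right, so real witnesses can be made rational; this turns the
    uncountable infima defining the times into countable unions of measurable sets. *)
Let rat_witness (t q : R) om : 0 <= t -> t < q ->
  exists r : rat, [/\ t < ratr r, ratr r < q & X (ratr r) om = X t om].
Proof.
move=> t0 tq; have [e e0 eP] := right_cst om t0.
have tm : t < Num.min q (t + e) by rewrite lt_min tq ltrDl.
have [r] := rat_in_itvoo tm; rewrite in_itv/= lt_min => /and3P[tr rq re].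
by exists r; split=> //; apply: eP; rewrite ltW.
Qed.

Lemma jump_time1_lt (q : R) om : (jump_time X 1 om < q%:E)%E <->
  exists r : rat, [/\ 0 < ratr r :> R, ratr r < q & X (ratr r) om <> X 0 om].
Proof.
split=> [/ereal_inf_lt[_ [t /= [t0 Xt] <-]]|[r [r0 rq Xr]]].
  rewrite lte_fin in t0; rewrite lte_fin => tq.
  have [r [tr rq rt]] := rat_witness om (ltW t0) tq.
  by exists r; split=> //; [exact: lt_trans tr|rewrite rt].
apply: (@le_lt_trans _ _ (ratr r)%:E); last by rewrite lte_fin.
by apply: ereal_inf_lbound; exists (ratr r) => //=; rewrite lte_fin.
Qed.

Lemma return_time_lt (q : R) om : (tau om < q%:E)%E <->
  exists r : rat, [/\ (jump_time X 1 om < (ratr r)%:E)%E,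
    ratr r < q & X (ratr r) om = x].
Proof.
split=> [/ereal_inf_lt[_ [t /= [t0 Xt] <-]]|[r [r0 rq Xr]]].
  rewrite lte_fin => tq.
  have t0' : 0 <= t.
    by rewrite -lee_fin; apply: le_trans (ltW t0); exact: jump_time1_ge0.
  have [r [tr rq rt]] := rat_witness om t0' tq.
  exists r; split=> //; last by rewrite rt.
  by apply: lt_trans t0 _; rewrite lte_fin.
apply: (@le_lt_trans _ _ (ratr r)%:E); last by rewrite lte_fin.
by apply: ereal_inf_lbound; exists (ratr r).
Qed.

Let measurable_change (r : R) : 0 <= r ->
  measurable [set om | X r om <> X 0 om].
Proof.
move=> r0.
have -> : [set om | X r om <> X 0 om] =
    ~` \bigcup_n (if unpickle n is Some y
      then X r @^-1` [set y] `&` X 0 @^-1` [set y] else set0).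
  apply/seteqP; split=> [om Xom [n _]|om H Xom].
    by case: (unpickle n) => [y [/= h1 h2]|//]; apply: Xom; rewrite h1 h2.
  by apply: H; exists (pickle (X r om)) => //; rewrite pickleK.
apply: measurableC; apply: bigcupT_measurable => n.
case: (unpickle n) => [y|]//.
by apply: measurableI; exact: (chain_measurable HX).
Qed.

Let measurable_jump_time1_lt (q : R) :
  measurable [set om | (jump_time X 1 om < q%:E)%E].
Proof.
have -> : [set om | (jump_time X 1 om < q%:E)%E] =
    \bigcup_(r : rat) (if (0 < ratr r :> R) && (ratr r < q)
      then [set om | X (ratr r) om <> X 0 om] else set0).
  apply/seteqP; split=> om /=.
    by move=> /jump_time1_lt[r [r0 rq Xr]]; exists r => //; rewrite r0 rq.
  move=> [r _]; case: ifPn => // /andP[r0 rq] Xr.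
  by apply/jump_time1_lt; exists r.
apply: bigcupT_measurable_rat => r; case: ifPn => // /andP[r0 _].
by apply: measurable_change; exact: ltW.
Qed.

Lemma measurable_return_time : measurable_fun [set: T] tau.
Proof.
apply: (measurability _ (ErealGenInftyO.measurableE R)) => _ /= -[_ [q ->] <-].
rewrite setTI.
have -> : tau @^-1` `]-oo, q%:E[ =
    \bigcup_(r : rat) (if (0 <= ratr r :> R) && (ratr r < q)
      then [set om | (jump_time X 1 om < (ratr r)%:E)%E] `&` X (ratr r) @^-1` [set x]
      else set0).
  apply/seteqP; split=> om /=; rewrite in_itv/=.
    move=> /return_time_lt[r [r0 rq Xr]]; exists r => //.
    suff -> : 0 <= ratr r :> R by rewrite rq.
    by rewrite -lee_fin; apply: le_trans (ltW r0); exact: jump_time1_ge0.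
  move=> [r _]; case: ifPn => // /andP[r0 rq] [jr Xr].
  by apply/return_time_lt; exists r.
apply: bigcupT_measurable_rat => r; case: ifPn => // /andP[r0 _].
by apply: measurableI => //; exact: (chain_measurable HX).
Qed.

(** A departure and return seen on the grid are real ones: the first jump is at most i h, strictly
    before the visit at k h. Short excursions may be missed, so the converse needs a small mesh. *)
Lemma return_event_le (h : R) j om : 0 < h ->
  X 0 om = x -> return_event X x h j om -> (tau om <= (j%:R * h)%:E)%E.
Proof.
move=> h0 X0 [i [k [/andP[ik kj] Xi Xk]]].
have i0 : (0 < i)%N.
  by rewrite lt0n; apply/eqP => i0; apply: Xi; rewrite i0 mul0r.
apply: (@le_trans _ _ (k%:R * h)%:E); last by rewrite lee_fin ler_pM2r// ler_nat.
apply: ereal_inf_lbound; exists (k%:R * h) => //=; split=> //.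
apply: (@le_lt_trans _ _ (i%:R * h)%:E); last by rewrite lte_fin ltr_pM2r// ltr_nat.
apply: ereal_inf_lbound; exists (i%:R * h) => //=; split.
  by rewrite lte_fin mulr_gt0// ltr0n.
by rewrite X0.
Qed.

(** Times satisfying Q occur arbitrarily close to the right of the infimum a, where X is constant;
    so Q holds at a and on an interval after it. *)
Let inf_attained (A : R -> Prop) (a : R) om (Q : I -> Prop) :
  0 <= a -> ereal_inf [set t%:E | t in [set t | A t /\ Q (X t om)]] = a%:E ->
  exists2 e, 0 < e & forall s, a <= s < a + e -> X s om = X a om /\ Q (X s om).
Proof.
move=> a0 aE; have [e e0 eP] := right_cst om a0.
have : (ereal_inf [set t%:E | t in [set t | A t /\ Q (X t om)]] < (a + e)%:E)%E.
  by rewrite aE lte_fin ltrDl.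
move=> /ereal_inf_lt[_ [t [At Qt] <-]]; rewrite lte_fin => tae.
have ta : a <= t.
  by rewrite -lee_fin -aE; apply: ereal_inf_lbound; exists t.
have Qa : Q (X a om) by rewrite -(eP t)// ta.
by exists e => // s sae; rewrite eP.
Qed.

Lemma return_event_near (u : R) om : X 0 om = x -> tau om = u%:E ->
  exists2 e, 0 < e & forall h, 0 < h < e ->
    exists k, return_event X x h k om /\ k%:R * h <= u + h.
Proof.
move=> X0 uE.
have : (jump_time X 1 om <= u%:E)%E by rewrite -uE jump_time1_le_return_time.
have := jump_time1_ge0 om.
case aE : (jump_time X 1 om) => [a| |]//; rewrite !lee_fin => a0 au.
have u0 : 0 <= u by exact: le_trans au.
have [e1 e10 e1P] := @inf_attained (fun t => (0 < t%:E)%E) a om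
  (fun y => y <> X 0 om) a0 aE.
have [e2 e20 e2P] := @inf_attained (fun t => (jump_time X 1 om < t%:E)%E) u om
  (fun y => y = x) u0 uE.
have Xa : X a om <> x.
  have ae1 : a <= a < a + e1 by rewrite lexx ltrDl.
  by have [_] := e1P a ae1; rewrite X0.
have Xu : X u om = x.
  have ue2 : u <= u < u + e2 by rewrite lexx ltrDl.
  by have [_] := e2P u ue2.
have au' : a < u.
  rewrite lt_neqAle au andbT; apply/eqP => ae; apply: Xa; rewrite ae//.
(* Below [e1] and [e2] the grid meets the holding intervals after the first jump a and after the
   return u; below u - a the first of these grid points precedes u. *)
exists (Num.min (Num.min e1 e2) (u - a)).
  by rewrite !lt_min e10 e20 subr_gt0.
move=> h /andP[h0]; rewrite !lt_min => /andP[/andP[he1 he2] hua].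
have grid (b : R) : 0 <= b -> exists i : nat, b < i%:R * h <= b + h.
  move=> b0; exists (Num.truncn (b / h)).+1.
  have bh0 : 0 <= b / h by rewrite divr_ge0// ltW.
  have /andP[h1 h2] := truncn_itv bh0.
  rewrite -ltr_pdivrMr// h2/= -natr1 mulrDl mul1r lerD2r.
  by rewrite -ler_pdivlMr.
have [i /andP[ai ia]] := grid a a0; have [k /andP[uk ku]] := grid u u0.
exists k; split=> //; exists i, k; split.
- by rewrite leqnn andbT -(ltr_nat R) -(ltr_pM2r h0); lra.
- have ie : a <= i%:R * h < a + e1 by apply/andP; split; lra.
  by have [-> _] := e1P _ ie.
- have ke : u <= k%:R * h < u + e2 by apply/andP; split; lra.
  by have [-> _] := e2P _ ke.
Qed.

End ReturnTime.

Section TruncatedMeanLimit.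
Context {R : realType} (I : countType) (p : R -> I -> I -> R).
Context d (T : measurableType d) (P : I -> probability T R) (X : R -> T -> I).
Hypothesis HX : markov_chain p P X.
Variable x : I.
Variable t : R.
Hypothesis t0 : 0 < t.
Local Notation tau := (return_time X x).
Local Notation h n := (t / n.+1%:R).

Let h0 n : 0 < h n. Proof. by rewrite divr_gt0. Qed.

Let hN n : h n * n.+1%:R = t. Proof. by rewrite divfK. Qed.

Let unreturned n om (j : nat) : bool := `[< ~ return_event X x (h n) j om >].

(* The first step at which a return is seen (or n.+1), times the mesh. *)
Let f n om : R := h n * (\sum_(j < n.+1) unreturned n om j)%:R.

Let unreturned_noninc n om j k : (j <= k)%N ->
  unreturned n om k -> unreturned n om j.
Proof.
move=> jk /asboolP nk; apply/asboolP => -[i [l [/andP[il lj] Xi Xl]]].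
by apply: nk; exists i, l; split=> //; rewrite il (leq_trans lj).
Qed.

Let m om := fine (mine (tau om) t%:E).

Let mE om : (m om)%:E = mine (tau om) t%:E.
Proof.
rewrite /m fineK// ge0_fin_numE.
  by rewrite (@le_lt_trans _ _ t%:E) ?ltry// ge_min lexx orbT.
by rewrite le_min return_time_ge0 lee_fin ltW.
Qed.

Let f_le n om : f n om <= t.
Proof.
rewrite -[leRHS](hN n); apply: ler_wpM2l; first exact: ltW.
rewrite ler_nat -[leqRHS]card_ord -sum1_card.
by apply: leq_sum => j _; case: unreturned.
Qed.

Let f_ge0 n om : 0 <= f n om.
Proof. by rewrite mulr_ge0// ltW. Qed.

Let m_le_f n om : X 0 om = x -> m om <= f n om.
Proof.
move=> X0; rewrite -lee_fin mE.
have [+ _] := @sum_noninc_bool (unreturned n om) n.+1 (@unreturned_noninc n om).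
rewrite /f; set c := (\sum_(j < n.+1) _)%N => H.
have [/H cret|nc] := ltnP c n.+1; last first.
  apply: (@le_trans _ _ t%:E); first by rewrite ge_min lexx orbT.
  by rewrite lee_fin -[leLHS](hN n) ler_wpM2l ?ler_nat// ltW.
have ret : return_event X x (h n) c om.
  by apply: contrapT => nr; move/negP: cret; apply; exact/asboolP.
rewrite ge_min mulrC; apply/orP; left.
exact: return_event_le.
Qed.

Let h_cvg0 : h n @[n --> \oo] --> (0 : R).
Proof.
rewrite -[X in _ --> X](mulr0 t); apply: cvgM; first exact: cvg_cst.
exact: cvg_harmonic.
Qed.

Let f_le_m om : X 0 om = x -> \forall n \near \oo, f n om <= m om + h n.
Proof.
move=> X0.
have [tt|/ltW] := leP t%:E (tau om).
  apply: nearW => n; have -> : m om = t by rewrite /m min_r.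
  by apply: (le_trans (f_le n om)); rewrite lerDl ltW.
have := return_time_ge0 X x om.
case uE : (tau om) => [u| |]// _; rewrite lee_fin => ut.
have -> : m om = u by rewrite /m uE min_l.
have [e e0 eP] := return_event_near HX X0 uE.
have : \forall n \near \oo, h n < e by exact: (cvgr_lt _ h_cvg0).
apply: filterS => n he; have [|k [rk kh]] := eP (h n); first by rewrite h0.
apply: le_trans kh; rewrite /f mulrC ler_pM2r// ler_nat.
have [_] := @sum_noninc_bool (unreturned n om) n.+1 (@unreturned_noninc n om).
by apply; apply/negP => /asboolP.
Qed.

Let f_cvg om : X 0 om = x -> f n om @[n --> \oo] --> m om.
Proof.
move=> X0; apply: (@squeeze_cvgr _ _ _ _ (fun=> m om) (fun n => m om + h n)).
- have := f_le_m X0; apply: filterS => n ->; rewrite andbT; exact: m_le_f.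
- exact: cvg_cst.
- rewrite -[X in _ --> X]addr0; apply: cvgD => //; exact: cvg_cst.
Qed.

Let E0 := X 0 @^-1` [set x].

Let mE0 : measurable E0. Proof. exact: (chain_measurable HX). Qed.

Let mret n j : measurable (return_event X x (h n) j).
Proof. exact: (measurable_return_event HX x (h0 n)). Qed.

Let f_indic n om :
  (f n om)%:E = ((h n)%:E * \sum_(j < n.+1) (\1_(~` return_event X x (h n) j) om)%:E)%E.
Proof.
rewrite /f EFinM natr_sum -sumEFin; congr (_ * _)%E; apply: eq_bigr => j _.
Qed.

Let mf n (D : set T) : measurable_fun D (fun om => (f n om)%:E).
Proof.
under eq_fun do rewrite f_indic.
apply: emeasurable_funM => //; apply: emeasurable_sum => j.
by apply/measurable_EFinP; apply: measurable_indic; exact: measurableC.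
Qed.

Let integral_f n : (\int[P x]_(om in E0) (f n om)%:E =
  (h n * \sum_(j < n.+1) no_return_prob P X x (h n) j)%:E)%E.
Proof.
under eq_integral do rewrite f_indic.
have m1 (j : 'I_n.+1) : measurable_fun E0
    (fun om => (\1_(~` return_event X x (h n) j) om)%:E).
  by apply/measurable_EFinP; apply: measurable_indic; exact: measurableC.
rewrite ge0_integralZl_EFin//; last 3 first.
- by move=> om _; apply: sume_ge0 => j _; rewrite lee_fin.
- by apply: emeasurable_sum.
- exact: ltW.
rewrite ge0_integral_sum//.
rewrite [RHS]EFinM -sumEFin; congr (_ * _)%E; apply: eq_bigr => j _.
rewrite integral_indic//; last exact: measurableC.
rewrite /no_return_prob fineK; last first.
  apply: fin_num_measure; apply: measurableD => //; apply: measurableI => //.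
  by rewrite mul0r.
by rewrite mul0r setTI setIC.
Qed.

(** [f n] is h times a sum of indicators, so its mean over X_0 = x is the left side. It converges to
    min(tau, t) there and is bounded by t; dominated convergence applies, and X_0 = x has full
    probability. *)
Lemma no_return_sums_cvg :
  h n * (\sum_(j < n.+1) no_return_prob P X x (h n) j) @[n --> \oo]
    --> fine (truncated_mean (P x) tau t).
Proof.
have mtau := measurable_return_time HX x.
have mm (D : set T) : measurable_fun D (fun om => (m om)%:E).
  under eq_fun do rewrite mE.
  by apply: measurable_funTS; exact: measurable_truncation.
have PE0 : P x (~` E0) = 0%E.
  by rewrite probability_setC// (chain_start HX) subee.
have trE : truncated_mean (P x) tau t = (\int[P x]_(om in E0) (m om)%:E)%E.
  rewrite /truncated_mean; under eq_integral do rewrite -mE.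
  rewrite (@ge0_negligible_integral _ _ _ _ setT (~` E0))//.
  - by rewrite setTD setCK.
  - exact: measurableC.
  - by move=> om _; rewrite mE le_min return_time_ge0 lee_fin ltW.
have ae_cvg : \forall om \ae P x,
    E0 om -> (f n om)%:E @[n --> \oo] --> (m om)%:E.
  apply: aeW => om X0; apply: cvg_EFin; first exact: nearW.
  exact: f_cvg.
have ae_dom : \forall om \ae P x,
    forall n, E0 om -> (`|(f n om)%:E| <= cst t%:E om)%E.
  apply: aeW => om n _; rewrite gee0_abs; first by rewrite lee_fin.
  by rewrite lee_fin.
have icst : (P x).-integrable E0 (cst t%:E).
  apply/integrableP; split; first exact: measurable_cst.
  under eq_integral do rewrite gee0_abs ?lee_fin ?ltW//.
  rewrite integral_cst// -ge0_fin_numE.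
    by apply: fin_numM => //; exact: fin_num_measure.
  by rewrite mule_ge0// lee_fin ltW.
have [_ _] := dominated_convergence mE0 (fun n => mf n (D := E0)) (mm E0)
  ae_cvg icst ae_dom.
rewrite -trE.
have -> : (fun n => \int[P x]_(om in E0) (f n om)%:E)%E =
    (fun n => (h n * \sum_(j < n.+1) no_return_prob P X x (h n) j)%:E).
  by apply/funext => n; exact: integral_f.
have -> : truncated_mean (P x) tau t = (fine (truncated_mean (P x) tau t))%:E.
  rewrite fineK// ge0_fin_numE.
    apply: (@le_lt_trans _ _ t%:E); last exact: ltry.
    by apply: truncated_mean_le => //; [exact: return_time_ge0|exact: ltW].
  by apply: truncated_mean_ge0; [exact: return_time_ge0|exact: ltW].
by move/fine_cvg.
Qed.

End TruncatedMeanLimit.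

(** * Continuous-time bounds for the occupation time, and the equivalences *)

Section OccupationReturn.
Context {R : realType} (I : countType) (p : R -> I -> I -> R) (q : I -> I -> R).
Context d (T : measurableType d) (P : I -> probability T R) (X : R -> T -> I).
Hypothesis Hp : honest_standard_transition_function p.
Hypothesis Hq : is_Qmatrix p q.
Hypothesis HX : markov_chain p P X.
Variable x : I.
Local Notation tau := (return_time X x).
Local Notation M t := (fine (truncated_mean (P x) tau t)).

Lemma no_return_prob_ge0 (h : R) j : 0 <= no_return_prob P X x h j.
Proof. exact: fine_ge0. Qed.

Lemma no_return_prob_noninc (h : R) j k : 0 < h -> (j <= k)%N ->
  no_return_prob P X x h k <= no_return_prob P X x h j.
Proof.
move=> h0 jk.
have mE l : measurable (setT `&` X (0%:R * h) @^-1` [set x] `\` return_event X x h l).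
  apply: measurableD; last exact: (measurable_return_event HX x h0).
  by apply: measurableI => //; apply: (chain_measurable HX); rewrite mul0r.
apply: fine_le; try exact: fin_num_measure.
apply: le_measure; rewrite ?inE; [exact: mE|exact: mE|].
move=> om [X0 nk]; split=> // -[i [l [/andP[il lj] Xi Xl]]].
by apply: nk; exists i, l; split=> //; rewrite il (leq_trans lj).
Qed.

Lemma discrete_bounds (h : R) n : 0 < h ->
  let U := \sum_(k < n.+1) p (k%:R * h) x x in
  let B := \sum_(j < n.+1) no_return_prob P X x h j in
  n.+1%:R <= U * ((1 - p h x x + n.+1%:R^-1) * B) /\
  U * ((1 - p h x x) * B) <= 2 * n.+1%:R.
Proof.
move=> h0 U B.
have u0 k : 0 <= p (k%:R * h) x x.
  by apply: (transition_ge0 Hp); rewrite mulr_ge0// ltW.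
have a01 : 0 <= p h x x <= 1.
  by rewrite (transition_ge0 Hp) ?(transition_diag_le1 Hp)// ltW.
have r0 k : 0 <= avoid_prob P X x h k by exact: avoid_prob_ge0.
split.
  apply: (@renewal_sums_lower _ (fun k => p (k%:R * h) x x) (avoid_prob P X x h)
    (no_return_prob P X x h)) => //.
  - exact: no_return_prob_ge0.
  - by move=> j k; exact: no_return_prob_noninc.
  - by move=> m; exact: (last_exit Hp HX).
  - by move=> j; exact: (no_return_probE Hp HX).
apply: (@renewal_sums_upper _ (fun k => p (k%:R * h) x x) (avoid_prob P X x h)
    (no_return_prob P X x h)) => //.
- exact: no_return_prob_ge0.
- by move=> m; exact: (last_exit Hp HX).
- by move=> j; exact: (no_return_probE Hp HX).
Qed.

(** Multiply the discrete bounds by h = t / (n + 1): each of the two sums takes a factor h, 1 - p(h,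
    x, x) takes 1/h and tends to q, and 1 / (n + 1) = h / t leaves 1/t. *)
Lemma occupation_return_bounds (t : R) : 0 < t ->
  t <= S_ p t x * ((- q x x + t^-1) * M t) /\
  S_ p t x * (- q x x * M t) <= 2 * t.
Proof.
move=> t0; pose h n : R := t / n.+1%:R.
have h0 n : 0 < h n by rewrite divr_gt0.
have hN n : h n * n.+1%:R = t by rewrite divfK.
have cU := @S_riemann_cvg _ _ _ Hp x t t0.
have cB := @no_return_sums_cvg _ _ _ _ _ _ _ HX x t t0.
have ch : h n @[n --> \oo] --> (0 : R)^'+.
  have ch0 : h n @[n --> \oo] --> (0 : R).
    rewrite -[X in _ --> X](mulr0 t); apply: cvgM; first exact: cvg_cst.
    exact: cvg_harmonic.
  move=> A [e /= e0 eA].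
  move/cvgrPdist_lt : ch0 => /(_ e e0); apply: filterS => n hn.
  exact: eA hn (h0 n).
have cq : (1 - p (h n) x x) / h n @[n --> \oo] --> - q x x.
  have Hqx : (p s x x - (x == x)%:R) / s @[s --> 0^'+] --> q x x by exact: Hq.
  have -> : (fun n => (1 - p (h n) x x) / h n) =
      (fun n => - ((p (h n) x x - (x == x)%:R) / h n)).
    by apply/funext => n; rewrite eqxx -mulNr opprB.
  by apply: cvgN; exact: (cvg_comp _ _ ch Hqx).
have ct : t^-1 @[_ --> \oo] --> t^-1 by exact: cvg_cst.
pose U n := \sum_(k < n.+1) p (k%:R * h n) x x.
pose B n := \sum_(j < n.+1) no_return_prob P X x (h n) j.
have c1 : h n * U n * (((1 - p (h n) x x) / h n + t^-1) * (h n * B n)) @[n --> \oo]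
    --> S_ p t x * ((- q x x + t^-1) * M t).
  by apply: cvgM; [exact: cU|apply: cvgM; [exact: cvgD|exact: cB]].
have c2 : h n * U n * (((1 - p (h n) x x) / h n) * (h n * B n)) @[n --> \oo]
    --> S_ p t x * (- q x x * M t).
  by apply: cvgM; [exact: cU|apply: cvgM; [exact: cq|exact: cB]].
have hn0 n := lt0r_neq0 (h0 n).
split.
  apply: (cvgr_to_ge c1); apply: nearW => n.
  have [H _] := discrete_bounds n (h0 n).
  have -> : h n * U n * (((1 - p (h n) x x) / h n + t^-1) * (h n * B n)) =
      h n * (U n * ((1 - p (h n) x x + n.+1%:R^-1) * B n)).
    have -> : n.+1%:R^-1 = t^-1 * h n by rewrite /h mulKf ?lt0r_neq0.
    by field; rewrite hn0 lt0r_neq0.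
  by rewrite -[leLHS](hN n) ler_pM2l.
apply: (cvgr_to_le c2); apply: nearW => n.
have [_ H] := discrete_bounds n (h0 n).
have -> : h n * U n * ((1 - p (h n) x x) / h n * (h n * B n)) =
    h n * (U n * ((1 - p (h n) x x) * B n)).
  by field.
by rewrite -[X in 2 * X](hN n) [leRHS]mulrCA ler_pM2l.
Qed.

End OccupationReturn.

Theorem theorem3p3 (R : realType) (I : countType)
    (p : R -> I -> I -> R) (q : I -> I -> R)
    (d : measure_display) (T : measurableType d)
    (P : I -> probability T R) (X : R -> T -> I)
    (Hp : honest_standard_transition_function p)
    (Hq : is_Qmatrix p q) (Hreg : regular_Qmatrix q)
    (HX : markov_chain p P X) (Hexp : non_explosive P X)
    (x : I) (w : R -> R) (t0 : R) (Hw : condition_C w t0) :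
  [<-> (\int[P x]_omega extend_at_infty w (return_time X x omega) < +oo)%E ;
       tail_integral_finite t0 (fun t => `|derive1n 2 w t| * (t / S_ p t x)) ;
       tail_integral_finite t0 (fun t => `|derive1n 2 w t| * (t / G_ p (1 / t) x)) ;
       tail_integral_finite t0
         (fun t => `|derive1n 2 w t| * (t - t * return_laplace P X x t)) ].
Proof.
have mtau := measurable_return_time HX x.
have tau0 := return_time_ge0 X x.
pose q0 := - q x x; have q00 : 0 < q0 by exact: Qmatrix_diag Hreg x.
have t00 : 0 < t0 by exact: condC_t0_gt0 Hw.
pose M := truncated_mean (P x) (return_time X x).
pose m t := fine (M t).
have ME t : 0 < t -> M t = (m t)%:E.
  move=> tpos; rewrite fineK// ge0_fin_numE.
    apply: (@le_lt_trans _ _ t%:E); last exact: ltry.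
    by apply: truncated_mean_le => //; exact: ltW.
  by apply: truncated_mean_ge0 => //; exact: ltW.
have m_nd s t : 0 < s -> s <= t -> m s <= m t.
  move=> s0 st; rewrite -lee_fin -!ME//; last exact: lt_le_trans st.
  by apply: le_truncated_mean => //; exact: ltW.
(* An upper bound of q + 1/t that is uniform in t >= t0. *)
pose b := q0 + t0^-1.
have b0 : 0 < b by rewrite addr_gt0// invr_gt0.
have bounds t : t0 <= t -> [/\ 0 < t, 0 < S_ p t x, 0 < m t,
    t <= S_ p t x * (b * m t) & S_ p t x * (q0 * m t) <= 2 * t].
  move=> tt; have tpos : 0 < t by exact: lt_le_trans tt.
  have [h1 h2] := occupation_return_bounds Hp Hq HX x tpos.
  have m0 : 0 <= m t.
    by rewrite -lee_fin -ME//; apply: truncated_mean_ge0 => //; exact: ltW.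
  have S0 : 0 <= S_ p t x by apply: (S_ge0 Hp); exact: ltW.
  have h3 : t <= S_ p t x * (b * m t).
    apply: (le_trans h1); apply: ler_wpM2l => //; apply: ler_wpM2r => //.
    by rewrite lerD2l lef_pV2.
  have Sbm : 0 < S_ p t x * (b * m t) by exact: lt_le_trans h3.
  split=> //.
    rewrite lt_neqAle S0 andbT; apply/eqP => SE.
    by move: Sbm; rewrite -SE mul0r ltxx.
  rewrite lt_neqAle m0 andbT; apply/eqP => mE.
  by move: Sbm; rewrite -mE !mulr0 ltxx.
(* With s = (n + 1) t: S_s q0 m(t) <= S_s q0 m(s) <= 2 s <= 2 (n + 1) S_t b m(t), and m(t) > 0
   cancels. *)
pose K := 2 * b / q0.
have K0 : 0 < K by rewrite divr_gt0// mulr_gt0.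
have growth t n : t0 <= t -> S_ p (n.+1%:R * t) x <= n.+1%:R * K * S_ p t x.
  move=> tt; have [tpos S0 m0 h1 _] := bounds t tt.
  have tn : t <= n.+1%:R * t by apply: ler_peMl; [exact: ltW|rewrite ler1n].
  have [_ _ _ _ h2] := bounds _ (le_trans tt tn).
  have qm : 0 < q0 * m t by rewrite mulr_gt0.
  rewrite -(ler_pM2r qm).
  have -> : n.+1%:R * K * S_ p t x * (q0 * m t) =
      2 * (n.+1%:R * (S_ p t x * (b * m t))).
    by rewrite /K; field; exact: lt0r_neq0.
  apply: (@le_trans _ _ (2 * (n.+1%:R * t))); last by rewrite !ler_pM2l ?ltr0n.
  apply: le_trans h2; rewrite ler_wpM2l//.
    by apply: (S_ge0 Hp); rewrite mulr_ge0// ltW.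
  by rewrite ler_pM2l// m_nd.
have resolvent t : t0 <= t ->
    expR (- 1) * S_ p t x <= G_ p (1 / t) x <= 4 * (K * S_ p t x).
  move=> tt; have [tpos _ _ _ _] := bounds t tt.
  apply: (resolvent_bounds Hp tpos); first exact: ltW.
  by move=> n; exact: growth.
have H1 := weight_moment_finite (P x) Hw mtau tau0.
have e0 : 0 < expR (- 1) :> R by exact: expR_gt0.
have H2 : tail_integral_finite t0 (fun t => `|derive1n 2 w t| * (t / S_ p t x)) <->
   (\int[lebesgue_measure]_(s in `[t0, +oo[) ((`|derive1n 2 w s|)%:E * M s) < +oo)%E.
  apply: (@tail_integral_finiteE _ _ _ (P x) _ _ Hw _ mtau tau0
    (fun t => t / S_ p t x) (q0 / 2) b); first by rewrite divr_gt0.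
  - move=> t tt; have [tpos S0 m0 h1 h2] := bounds t tt.
    rewrite -/M ME// -EFinM lee_fin ler_pdivlMr//; lra.
  - move=> t tt; have [tpos S0 m0 h1 h2] := bounds t tt.
    rewrite -/M ME// -EFinM lee_fin ler_pdivrMr//; lra.
have H3 : tail_integral_finite t0
     (fun t => `|derive1n 2 w t| * (t / G_ p (1 / t) x)) <->
   (\int[lebesgue_measure]_(s in `[t0, +oo[) ((`|derive1n 2 w s|)%:E * M s) < +oo)%E.
  (* From G <= 4 K S and S q0 m <= 2 t comes q0 / (8 K) m G <= t; from G >= S / e and t <= S b m
     comes t <= e b m G. *)
  apply: (@tail_integral_finiteE _ _ _ (P x) _ _ Hw _ mtau tau0
    (fun t => t / G_ p (1 / t) x) (q0 / (8 * K)) (b / expR (- 1))).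
  - by rewrite divr_gt0// mulr_gt0.
  - move=> t tt; have [tpos S0 m0 h1 h2] := bounds t tt.
    have /andP[g1 g2] := resolvent t tt.
    have G0 : 0 < G_ p (1 / t) x by apply: lt_le_trans g1; rewrite mulr_gt0.
    rewrite -/M ME// -EFinM lee_fin ler_pdivlMr//.
    have c0 : 0 <= q0 / (8 * K) * m t.
      by rewrite mulr_ge0 ?ltW// divr_gt0// mulr_gt0.
    apply: (le_trans (ler_wpM2l c0 g2)).
    have -> : q0 / (8 * K) * m t * (4 * (K * S_ p t x)) =
        S_ p t x * (q0 * m t) / 2 by field; exact: lt0r_neq0.
    lra.
  - move=> t tt; have [tpos S0 m0 h1 h2] := bounds t tt.
    have /andP[g1 g2] := resolvent t tt.
    have G0 : 0 < G_ p (1 / t) x by apply: lt_le_trans g1; rewrite mulr_gt0.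
    rewrite -/M ME// -EFinM lee_fin ler_pdivrMr//.
    have c0 : 0 <= b / expR (- 1) * m t.
      by rewrite mulr_ge0 ?ltW// divr_gt0.
    apply: le_trans (ler_wpM2l c0 g1).
    have -> : b / expR (- 1) * m t * (expR (- 1) * S_ p t x) =
        S_ p t x * (b * m t) by field; exact: lt0r_neq0.
    exact: h1.
have H4 : tail_integral_finite t0
     (fun t => `|derive1n 2 w t| * (t - t * return_laplace P X x t)) <->
   (\int[lebesgue_measure]_(s in `[t0, +oo[) ((`|derive1n 2 w s|)%:E * M s) < +oo)%E.
  apply: (@tail_integral_finiteE _ _ _ (P x) _ _ Hw _ mtau tau0
    (fun t => t - t * return_laplace P X x t) (2^-1) 1) => //.
  - move=> t tt; have tpos : 0 < t by exact: lt_le_trans tt.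
    by have [] := laplace_truncated_mean (P x) mtau tau0 tpos.
  - move=> t tt; have tpos : 0 < t by exact: lt_le_trans tt.
    by rewrite mul1e; have [] := laplace_truncated_mean (P x) mtau tau0 tpos.
tfae.
- by move=> /H1 h; apply/H2.
- by move=> /H2 h; apply/H3.
- by move=> /H3 h; apply/H4.
- by move=> /H4 h; apply/H1.
Qed.
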